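(* Let $k$ be a field and let $G$ be a finite simple graph. Suppose that $G$ has an induced subgraph $H$ of the form $H = K_{n_1,n_1} \sqcup \cdots \sqcup K_{n_t,n_t}$ (disjoint union of complete bipartite graphs, $t\ge 1$) with each $n_i \geq 2$. Then the toric ideal $I_G$ satisfies \[\operatorname{reg}(I_G) \geq n_1+n_2 + \cdots + n_t - (t-1).\]
   Context: For a finite simple graph $G=(V,E)$ with $V=\{x_1,\dots,x_n\}$ and $E=\{e_1,\dots,e_r\}$, let $k[V]=k[x_1,\dots,x_n]$ and $k[E]=k[e_1,\dots,e_r]$ be polynomial rings over the field $k$ whose variables are the vertices, respectively the edges, of $G$. The toric ideal $I_G\subseteq k[E]$ is the kernel of the $k$-algebra map $\pi:k[E]\to k[V]$ sending each edge $e=\{x_a,x_b\}$ to $x_ax_b$. It is homogeneous for the standard grading of $k[E]$ (each $e_i$ has degree $1$). Writing $\beta_{i,j}(I_G)$ for the graded Betti numbers, i.e. the number of copies of $k[E](-j)$ in homological degree $i$ of the graded minimal free resolution of $I_G$ as a $k[E]$-module (homological degree $0$ corresponds to minimal generators of $I_G$), the Castelnuovo-Mumford regularity is $\operatorname{reg}(I_G)=\max\{j-i \mid \beta_{i,j}(I_G)\neq 0\}$. $K_{n,n}$ is the complete bipartite graph with both parts of size $n$. An induced subgraph on $W\subseteq V$ has vertex set $W$ and all edges of $G$ contained in $W$. *)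

(* Defs.v *)
From HB Require Import structures.
From mathcomp Require Import all_boot all_order all_algebra.
From mathcomp Require Export mpoly.

Set Implicit Arguments.
Unset Strict Implicit.
Unset Printing Implicit Defensive.

Import Order.TTheory GRing.Theory Num.Theory.

Local Open Scope ring_scope.

(** * Finite simple graphs *)

Record sgraph := SGraph {
  vertex :> finType;
  adj : rel vertex;
  adj_sym : ssrbool.symmetric adj;
  adj_irr : irreflexive adj
}.

Definition graph_iso (G H : sgraph) : Prop :=
  exists2 f : G -> H, bijective f & forall x y, adj (f x) (f y) = adj x y.

Section Induced.
Variables (G : sgraph) (W : {set G}).

Definition induced_adj : rel {x : G | x \in W} :=
  fun x y => adj (val x) (val y).

Lemma induced_sym : ssrbool.symmetric induced_adj.
Proof. by move=> x y; rewrite /induced_adj adj_sym. Qed.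

Lemma induced_irr : irreflexive induced_adj.
Proof. by move=> x; rewrite /induced_adj adj_irr. Qed.

Definition induced : sgraph := SGraph induced_sym induced_irr.
End Induced.

Section CompleteBipartite.
Variables m n : nat.

Definition bip_adj : rel ('I_m + 'I_n)%type := fun x y =>
  match x, y with
  | inl _, inr _ | inr _, inl _ => true
  | _, _ => false
  end.

Lemma bip_sym : ssrbool.symmetric bip_adj. Proof. by move=> [x|x] [y|y]. Qed.

Lemma bip_irr : irreflexive bip_adj. Proof. by case. Qed.

Definition complete_bipartite : sgraph := SGraph bip_sym bip_irr.
End CompleteBipartite.

Section DisjointUnion.
Variables (I : finType) (G : I -> sgraph).

(* [tagged_as u v] is the second component of [v] transported to the graph of
   [u]; it is only relevant when the two indices agree. *)
Definition dunion_adj : rel {i : I & G i} := fun u v =>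
  (tag u == tag v) && adj (tagged u) (tagged_as u v).

Lemma dunion_sym : ssrbool.symmetric dunion_adj.
Proof.
move=> [i x] [j y]; rewrite /dunion_adj /=.
have [eq_ij|//] := eqVneq i j.
by case: j / eq_ij y => y; rewrite !tagged_asE adj_sym.
Qed.

Lemma dunion_irr : irreflexive dunion_adj.
Proof. by move=> [i x]; rewrite /dunion_adj eqxx tagged_asE adj_irr. Qed.

Definition disjoint_union : sgraph := SGraph dunion_sym dunion_irr.
End DisjointUnion.

(** * Toric ideals of graphs *)

Section Toric.
Variables (k : fieldType) (G : sgraph).

Definition edges : {set {set G}} :=
  [set [set x; y] | x in G, y in G & adj x y].

(* The variables of k[V] and k[E] are numbered along the enumerations of the
   vertices and of the edges. *)
Definition vertex_ring := {mpoly k[#|G|]}.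
Definition edge_ring := {mpoly k[#|edges|]}.

Definition edge_monomial (i : 'I_#|edges|) : vertex_ring :=
  \prod_(x in enum_val i) 'X_(enum_rank x).

Definition toric_map (p : edge_ring) : vertex_ring :=
  p \mPo [tuple edge_monomial i | i < #|edges|].

Definition toric_ideal (p : edge_ring) : Prop := toric_map p = 0.
End Toric.

(** * Graded minimal free resolutions *)

(* A graded minimal free resolution
     0 -> F_p -> ... -> F_1 -> F_0 -> I -> 0
   of the ideal I of S = k[X_0, ..., X_(r-1)] with its standard grading, where
   F_i is the direct sum of the S(- res_shift i a) for a < res_rank i (only
   nonnegative shifts can occur, as I lies in S).  Elements of F_i are row
   vectors and matrices act on the right: row a of [res_aug], respectively
   [res_diff i], is the image in I, respectively F_i, of the a-th basis element
   of F_0, respectively F_(i+1).  The maps are homogeneous of degree 0, which is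
   stated monomial by monomial, so that entries which would need a negative
   degree vanish.  F_i is given for all i and is 0 from some point on. *)
Record minimal_resolution (k : fieldType) (r : nat) (I : {mpoly k[r]} -> Prop) :=
  MinimalResolution {
  res_rank : nat -> nat;
  res_shift : forall i, 'I_(res_rank i) -> nat;
  res_aug : 'cV[{mpoly k[r]}]_(res_rank 0);
  res_diff : forall i, 'M[{mpoly k[r]}]_(res_rank i.+1, res_rank i);
  res_aug_homog : forall a m,
    m \in msupp (res_aug a ord0) -> mdeg m = res_shift a;
  res_diff_homog : forall i a b m,
    m \in msupp (res_diff i a b) -> (mdeg m + res_shift b)%N = res_shift a;
  res_aug_image : forall p,
    I p <-> exists x : 'rV_(res_rank 0), x *m res_aug = p%:M;
  res_exact0 : forall x : 'rV_(res_rank 0),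
    x *m res_aug = 0 <-> exists y, x = y *m res_diff 0;
  res_exactS : forall i (x : 'rV_(res_rank i.+1)),
    x *m res_diff i = 0 <-> exists y, x = y *m res_diff i.+1;
  (* the image of F_(i+1) lies in (X_0, ..., X_(r-1)) F_i *)
  res_minimal : forall i a b, (res_diff i a b)@_0 = 0;
  res_finite : exists p, forall i, (p <= i)%N -> res_rank i = 0%N
}.

Section Betti.
Variables (k : fieldType) (r : nat) (I : {mpoly k[r]} -> Prop).
Variable F : minimal_resolution I.

Definition betti (i j : nat) : nat :=
  #|[set a : 'I_(res_rank F i) | res_shift a == j]|.

Definition is_regularity (m : int) : Prop :=
  (exists i j, betti i j <> 0%N /\ m = j%:Z - i%:Z) /\
  (forall i j, betti i j <> 0%N -> j%:Z - i%:Z <= m).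
End Betti.

(* Main.v *)
(** The Koszul homology of [k[E]/I_G] splits along the vertex multidegrees, and
in the multidegree [alpha] equal to [n_s - 1] on every vertex of the [s]-th
component of [H] and to [0] outside [W] it only sees the edges of [H].  A face
is then a set of edges of [H], that is of cells of the [n_s x n_s] grids, that
contains no full row and no full column.  The join of the boundaries of the
simplices on all rows but the last one of each grid is a cycle supported on
such faces, with [q = sum_s (n_s - 1)^2] cells each.  The indicator of the
complements of staircases (maximal chains in each grid) is a cocycle, because a
staircase deprived of a cell that still meets every row and column is completed
by exactly two cells, the two corners of a unit square.  The two meet in a
single face, so the class is nonzero.  A zigzag through the double complex
(resolution) (x) (Koszul complex) turns it into a basis element of [F_(q-1)] of
degree [|alpha| / 2 = sum_s n_s (n_s - 1)], which contributes
[sum_s (n_s - 1) + 1] to the regularity. *)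

Require Import Defs.
From mathcomp Require Import all_boot all_order all_algebra.
From mathcomp Require Import zify ring.

Set Implicit Arguments.
Unset Strict Implicit.
Unset Printing Implicit Defensive.

Import GRing.Theory.

Local Open Scope ring_scope.

(** * Koszul complexes *)

Section Contraction.

Variables (T : finType) (lt : rel T).
Hypothesis ltC : forall a b, a != b -> lt a b = ~~ lt b a.

(** The exponent of the sign attached to [b] in the Koszul differential, for an arbitrary tournament
    [lt]. *)
Definition rank_in (b : T) (A : {set T}) : nat := #|[set a in A | lt a b]|.

Lemma rank_inU b c (A : {set T}) :
  b \notin A -> rank_in c (b |: A) = (lt b c + rank_in c A)%N.
Proof.
move=> bA; rewrite /rank_in.
have -> : [set a in b |: A | lt a c]
    = (if lt b c then [set b] else set0) :|: [set a in A | lt a c].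
  apply/setP => a; rewrite !inE.
  have [->|ab] := eqVneq a b; case: ifP => lbc; rewrite !inE ?eqxx ?(negbTE ab) //.
  by rewrite !andbF.
by case: (lt b c); rewrite ?set0U // cardsU1 !inE (negbTE bA).
Qed.

(** [lt] splits the ordered pairs into two halves that cancel. Showing the sum equal to its opposite
    would not suffice in characteristic 2. *)
Lemma sum_antisym (V : zmodType) (P : pred T) (g : T -> T -> V) :
  (forall b c, P b -> P c -> b != c -> g b c = - g c b) ->
  \sum_(b | P b) \sum_(c | P c && (c != b)) g b c = 0.
Proof.
move=> gN.
under eq_bigr => b _ do rewrite (bigID (lt b)) /=.
rewrite big_split /= addrC.
rewrite (exchange_big_dep P) /=; last by move=> b c _ /andP[/andP[]].
rewrite -big_split big1 //= => c Pc; apply/eqP; rewrite addr_eq0 -sumrN.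
apply/eqP; rewrite (eq_bigl (fun b => P b && (b != c) && lt c b)); last first.
  move=> b; rewrite Pc [c == b]eq_sym; have [->|bc] := eqVneq b c.
    by rewrite !andbF.
  by rewrite (ltC bc) negbK /= andbT.
by apply: eq_bigr => b /andP[/andP[Pb bc] _]; rewrite (gN b c).
Qed.

Section Module.

Variables (K : comRingType) (V : lmodType K).

(** A chain is stored as its coefficients [w A] on the exterior basis, all degrees at once, and
    contracted by the form sending [e_b] to [x b]. Variables as [x] give the Koszul differential,
    the constant 1 the simplicial boundary. *)
Definition contr (x : T -> K) (w : {set T} -> V) (A : {set T}) : V :=
  \sum_(b | b \notin A) ((-1) ^+ rank_in b A * x b) *: w (b |: A).

Lemma eq_contr x w w' : w =1 w' -> contr x w =1 contr x w'.
Proof. by move=> ww' A; apply: eq_bigr => b _; rewrite ww'. Qed.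

Lemma contrB x w w' A :
  contr x (fun B => w B - w' B) A = contr x w A - contr x w' A.
Proof. by rewrite /contr -sumrB; apply: eq_bigr => b _; rewrite scalerBr. Qed.

Lemma contr_eq0 x w A : (forall B, w B = 0) -> contr x w A = 0.
Proof. by move=> w0; rewrite /contr big1 // => b _; rewrite w0 scaler0. Qed.

Lemma contr_contr x y w A :
  contr x (contr y w) A = \sum_(b | b \notin A) \sum_(c | (c \notin A) && (c != b))
    ((-1) ^+ (rank_in b A + rank_in c A + lt b c) * (x b * y c))
      *: w (b |: (c |: A)).
Proof.
apply: eq_bigr => b bA; rewrite scaler_sumr; apply: eq_big => [c|c].
  by rewrite !inE negb_or andbC.
rewrite !inE negb_or => /andP[cb cA].
by rewrite scalerA rank_inU // setUCA !exprD; congr (_ *: _); ring.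
Qed.

Lemma contrC x y w A : contr x (contr y w) A = - contr y (contr x w) A.
Proof.
rewrite !contr_contr -sumrN.
rewrite (exchange_big_dep (fun b => b \notin A)) /=; last first.
  by move=> b c _ /andP[].
apply: eq_bigr => c cA; rewrite -sumrN; apply: eq_big => [b|b].
  by rewrite cA eq_sym.
move=> /andP[bA /andP[_ cb]]; rewrite setUCA -scaleNr (ltC cb).
by case: (lt b c); congr (_ *: _); rewrite !exprD /=; ring.
Qed.

(** [contrC] alone would only give twice this value; the terms are cancelled in pairs instead. *)
Lemma contr_sq x w A : contr x (contr x w) A = 0.
Proof.
rewrite contr_contr sum_antisym // => b c bA cA bc.
rewrite setUCA -scaleNr (ltC bc).
by case: (lt c b); congr (_ *: _); rewrite !exprD /=; ring.
Qed.

End Module.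

End Contraction.

Lemma contr_mulmx (T : finType) (lt : rel T) (K : comRingType) m n
    (x : T -> K) (w : {set T} -> 'rV_m) (M : 'M_(m, n)) A :
  contr lt x w A *m M = contr lt x (fun B => w B *m M) A.
Proof. by rewrite mulmx_suml; apply: eq_bigr => b _; rewrite scalemxAl. Qed.

Lemma contr_mxE (T : finType) (lt : rel T) (K : comRingType) m
    (x : T -> K) (w : {set T} -> 'rV_m) A l :
  contr lt x w A 0 l = contr lt x (fun B => w B 0 l : K^o) A.
Proof. by rewrite summxE; apply: eq_bigr => b _; rewrite mxE. Qed.

(** * Exactness of the Koszul complex on the variables *)

Section KoszulExact.

Variables (k : fieldType) (r : nat) (lt : rel 'I_r).
Hypothesis ltC : forall a b, a != b -> lt a b = ~~ lt b a.
Local Notation S := {mpoly k[r]}.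
Local Notation var := (fun b : 'I_r => 'X_b : S).

Lemma mcoeffXM (p : S) b m :
  ('X_b * p)@_m = if (0 < m b)%N then p@_(m - U_(b)) else 0.
Proof.
case: ifPn => [mb|].
  have Ub : (U_(b) <= m)%MM by rewrite lep1mP -lt0n.
  by rewrite -[m in LHS](submK Ub) addmC mulrC mcoeffMX.
rewrite -eqn0Ngt => /eqP mb; apply/eqP; rewrite mcoeff_eq0 mulrC.
rewrite (perm_mem (msuppMX _ _)); apply/mapP => -[m' _ mE].
by move: mb; rewrite mE mnmDE mnm1E eqxx.
Qed.

Lemma mcoeff_signM j (p : S) m : ((-1) ^+ j * p)@_m = (-1) ^+ j * p@_m.
Proof. by rewrite -(mcoeffCM ((-1) ^+ j)) rmorphXn /= rmorphN rmorph1. Qed.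

Lemma mcoeff_contr (w : {set 'I_r} -> S^o) A m : (contr lt var w A : S)@_m =
  \sum_(b | (b \notin A) && (0 < m b)%N)
    (-1) ^+ rank_in lt b A * (w (b |: A))@_(m - U_(b)).
Proof.
rewrite raddf_sum /= [LHS](bigID (fun b => 0 < m b)%N) /= addrC big1 ?add0r.
  apply: eq_bigr => b /andP[_ mb].
  by rewrite -[_ *: _]mulrA mcoeff_signM mcoeffXM mb.
move=> b /andP[_ /negbTE mb].
by rewrite -[_ *: _]mulrA mcoeff_signM mcoeffXM mb mulr0.
Qed.

(** Division by [X_v] of the terms selected by [Q], the building block of the contracting
    homotopy. *)
Definition lower (Q : pred 'X_{1..r}) (v : 'I_r) (p : S) : S :=
  \sum_(m <- msupp p | Q m && (0 < m v)%N) p@_m *: 'X_[m - U_(v)].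

Lemma mcoeff_lower Q v p m :
  (lower Q v p)@_m = if Q (m + U_(v))%MM then p@_(m + U_(v)) else 0.
Proof.
have lowerE (m' : 'X_{1..r}) : (0 < m' v)%N -> ((m' - U_(v))%MM == m) = (m' == (m + U_(v))%MM).
  move=> m'v; have Uv : (U_(v) <= m')%MM by rewrite lep1mP -lt0n.
  by apply/eqP/eqP => [<-|->]; rewrite ?submK ?addmK.
rewrite /lower raddf_sum /= big_mkcond /=.
under eq_bigr => m' _ do rewrite mcoeffZ mcoeffX.
have [mp|mp] := boolP ((m + U_(v))%MM \in msupp p); last first.
  rewrite (memN_msupp_eq0 mp) if_same big1_seq // => m' /andP[_ m'p].
  case: ifP => // /andP[_ m'v]; rewrite lowerE //.
  by case: eqP m'p mp => [->->|]; rewrite ?mulr0.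
rewrite (big_rem _ mp) /= mnmDE mnm1E eqxx addn1 andbT addmK eqxx mulr1.
rewrite big1_seq ?addr0 // => m' /andP[_ m'p]; case: ifP => // /andP[_ m'v].
rewrite lowerE //; case: eqP m'p => [->|]; rewrite ?mulr0 //.
by rewrite mem_rem_uniq ?msupp_uniq // inE eqxx.
Qed.

Definition mset (A : {set 'I_r}) : 'X_{1..r} := [multinom (b \in A : nat) | b < r].

Definition pivot (m : 'X_{1..r}) : option 'I_r := [pick v | m v != 0%N].

(* In a multidegree [m + mset A] the Koszul complex is the chain complex of a
   full simplex, contracted by coning off the vertex [pivot (m + mset A)]. *)
Lemma koszul_exact (w : {set 'I_r} -> S^o) :
  (forall A, contr lt var w A = 0) -> (w set0)@_0 = 0 ->
  exists2 u : {set 'I_r} -> S^o, u set0 = 0 &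
    forall A, w A = contr lt var u A.
Proof.
move=> wcyc w0.
(* [Q A v] selects the terms of [w (A :\ v)] whose total multidegree has pivot [v]. *)
pose Q (A : {set 'I_r}) v m := pivot (m + mset (A :\ v)) == Some v.
pose u (A : {set 'I_r}) : S :=
  \sum_(v in A) (-1) ^+ rank_in lt v (A :\ v) * lower (Q A v) v (w (A :\ v)).
have uE A m : (u A)@_m = if pivot (m + mset A) is Some v then
    if v \in A then (-1) ^+ rank_in lt v (A :\ v) * (w (A :\ v))@_(m + U_(v))
    else 0 else 0.
  have QE v : v \in A -> Q A v (m + U_(v))%MM = (pivot (m + mset A) == Some v).
    move=> vA; rewrite /Q; congr (pivot _ == _); apply/mnmP => b.
    rewrite !mnmE !inE eq_sym; case: eqVneq => [->|_]; first by rewrite vA; lia.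
    by rewrite addn0.
  rewrite raddf_sum /=.
  under eq_bigr => v vA do rewrite mcoeff_signM mcoeff_lower QE //.
  case: (pivot _) => [v|]; last by rewrite big1 // => v _; rewrite mulr0.
  have [vA|vA] := boolP (v \in A).
    rewrite (bigD1 v) //= eqxx big1 ?addr0 // => b /andP[_ bv].
    by case: eqP => [[vb]|]; rewrite ?mulr0 // vb eqxx in bv *.
  rewrite big1 // => b bA; case: eqP => [[vb]|]; rewrite ?mulr0 //.
  by rewrite vb bA in vA.
exists u; first by rewrite /u big_set0.
move=> A; apply/mpolyP => m; rewrite mcoeff_contr.
have degE b : b \notin A -> (0 < m b)%N ->
    (m - U_(b) + mset (b |: A) = m + mset A)%MM.
  move=> bA mb; apply/mnmP => c; rewrite !mnmE !inE [c == b]eq_sym.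
  case: eqVneq => [<-|_] /=; rewrite ?(negbTE bA) ?subn0 //.
  by rewrite subnK ?addn0.
under eq_bigr => b /andP[bA mb] do rewrite uE degE //.
(* Without a pivot the total multidegree is 0, and only the constant term of [w set0] is
   concerned. *)
rewrite /pivot; case: pickP => [v|T0]; last first.
  have mA : m = 0%MM /\ A = set0.
    split; first by apply/mnmP => b; have := T0 b; rewrite !mnmE; lia.
    by apply/setP => b; have := T0 b; rewrite !mnmE inE; case: (b \in A); lia.
  by rewrite mA.1 mA.2 w0 big1 // => b; rewrite mulr0.
(* If the pivot [v] is outside [A], only [b = v] contributes to the differential of [u], and it
   gives back [w A]. *)
rewrite !mnmE => Tv; have [vA|vA] := boolP (v \in A); last first.
  have mv : (0 < m v)%N by move: Tv; rewrite (negbTE vA); lia.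
  rewrite (bigD1 v) ?vA //= big1 => [|b /andP[_ bv]]; last first.
    by rewrite !inE [v == b]eq_sym (negbTE bv) (negbTE vA) mulr0.
  rewrite addr0 setU11 setU1K // mulrA -exprD addnn -mul2n exprM sqrrN expr1n.
  by rewrite expr1n mul1r submK // lep1mP -lt0n.
have vN : v \notin A :\ v by rewrite !inE eqxx.
(* If [v] is in [A], the cycle condition on [A :\ v] at the monomial [X_v m] expresses the
   coefficient of [w A] through the terms [b != v], which are those of the differential of [u]. *)
have := congr1 (fun p : S => p@_(m + U_(v))) (wcyc (A :\ v)).
rewrite mcoeff_contr mcoeff0 (bigD1 v) /=; last by rewrite vN mnmDE mnm1E eqxx addn1.
rewrite setD1K // addmK => /eqP; rewrite addr_eq0 => /eqP wE.
have sg2 : (-1) ^+ rank_in lt v (A :\ v) * (-1) ^+ rank_in lt v (A :\ v) = 1 :> k.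
  by rewrite -exprD addnn -mul2n exprM sqrrN !expr1n.
rewrite -[LHS]mul1r -[X in X * _ = _]sg2 -mulrA wE mulrN mulr_sumr -sumrN.
apply: eq_big => [b|b].
  rewrite !inE mnmDE mnm1E; case: (eqVneq b v) => [->|bv] /=.
    by rewrite vA andbF.
  by rewrite addn0 andbT.
move=> /andP[/andP[]]; rewrite !inE => bN mb bv; rewrite bv /= in bN.
move: mb; rewrite mnmDE mnm1E [v == b]eq_sym (negbTE bv) addn0 => mb.
rewrite vA orbT.
have -> : (b |: A) :\ v = b |: (A :\ v).
  by apply/setP => c; rewrite !inE; case: (eqVneq c b) => [->|]; rewrite ?bv.
have -> : (m - U_(b) + U_(v) = m + U_(v) - U_(b))%MM.
  apply/mnmP => c; rewrite !mnmE; case: (eqVneq b c) => [<-|]; last by lia.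
  by rewrite [v == b]eq_sym (negbTE bv); lia.
rewrite -mulNr !mulrA; congr (_ * _).
have bA : b \notin A :\ v by rewrite !inE bv.
have -> : rank_in lt b A = (lt v b + rank_in lt b (A :\ v))%N.
  by rewrite -{1}(setD1K vA) rank_inU.
rewrite rank_inU // (ltC bv) !exprD.
by case: (lt v b); rewrite /= ?expr0 ?expr1; ring.
Qed.

Lemma koszul_exact_row n (w : {set 'I_r} -> 'rV[S]_n) :
  (forall A, contr lt var w A = 0) -> (forall l, (w set0 0 l)@_0 = 0) ->
  exists2 u : {set 'I_r} -> 'rV[S]_n, u set0 = 0 &
    forall A, w A = contr lt var u A.
Proof.
move=> wcyc w0.
have /fin_all_exists[u uP] (l : 'I_n) : exists u : {set 'I_r} -> S^o,
    u set0 = 0 /\ forall A, w A 0 l = contr lt var u A.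
  have [A||u u0 uE] := @koszul_exact (fun A => w A 0 l).
  - by rewrite -contr_mxE wcyc mxE.
  - exact: w0.
  - by exists u.
exists (fun A => \row_l u l A).
  by apply/rowP => l; rewrite !mxE (uP l).1.
move=> A; apply/rowP => l; rewrite contr_mxE (uP l).2.
by apply: eq_bigr => b _; rewrite mxE.
Qed.

End KoszulExact.

(** * Zigzag between a resolution and the Koszul complex *)

Section Chase.

Variables (k : fieldType) (r : nat) (lt : rel 'I_r).
Hypothesis ltC : forall a b, a != b -> lt a b = ~~ lt b a.
Local Notation S := {mpoly k[r]}.
Local Notation var := (fun b : 'I_r => 'X_b : S).

Definition mrestrict (P : pred 'X_{1..r}) (p : S) : S :=
  \sum_(m <- msupp p | P m) p@_m *: 'X_[m].

Lemma mcoeff_mrestrict P p m :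
  (mrestrict P p)@_m = if P m then p@_m else 0.
Proof.
rewrite /mrestrict raddf_sum /= big_mkcond /=.
under eq_bigr => m' _ do rewrite mcoeffZ mcoeffX.
have [mp|mp] := boolP (m \in msupp p); last first.
  rewrite (memN_msupp_eq0 mp) if_same big1_seq // => m' /andP[_ m'p].
  by case: eqP m'p mp => [->->|]; rewrite ?mulr0 ?if_same.
rewrite (big_rem _ mp) /= eqxx mulr1.
rewrite big1_seq ?addr0 // => m' /andP[_].
rewrite mem_rem_uniq ?msupp_uniq // inE => /andP[/negbTE-> _].
by rewrite mulr0 if_same.
Qed.

Variables (rk : nat -> nat) (sh : forall i, 'I_(rk i) -> nat).
Variable D : forall i, 'M[S]_(rk i.+1, rk i).

Hypothesis D_homog : forall i a b m,
  m \in msupp (D i a b) -> (mdeg m + sh b)%N = sh a.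
Hypothesis D_exact : forall i (x : 'rV_(rk i.+1)),
  x *m D i = 0 <-> exists y, x = y *m D i.+1.

(* The part of total degree [j] in [F_i (x) K_c], where the generators of the
   Koszul factor [K_c] have degree [c]. *)
Definition homog_row i c j (x : 'rV[S]_(rk i)) :=
  forall a m, m \in msupp (x 0 a) -> (mdeg m + sh a + c)%N = j.

(** Since [D i] has degree 0, the part of [y] of total degree [j] already lifts [x]. *)
Lemma homog_lift i c j (x : 'rV_(rk i)) (y : 'rV_(rk i.+1)) :
  homog_row c j x -> x = y *m D i ->
  exists2 y', homog_row c j y' & x = y' *m D i.
Proof.
move=> xhom xE.
pose y' := \row_a mrestrict (fun m => mdeg m + sh a + c == j)%N (y 0 a).
exists y' => [a m|].
  by rewrite mxE mcoeff_msupp mcoeff_mrestrict; case: (_ =P j) => //; rewrite eqxx.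
apply/rowP => b; apply/mpolyP => m; have [mb|mb] := eqVneq (mdeg m + sh b + c)%N j.
  rewrite xE !mxE !raddf_sum; apply: eq_bigr => a _ /=.
  rewrite !mcoeffM; apply: eq_bigr => -[m1 m2] /= /eqP mE.
  have [d0|d0] := eqVneq (D i a b)@_m2 0; first by rewrite d0 !mulr0.
  have := D_homog (i := i) (a := a) (b := b) (m := m2).
  rewrite mcoeff_msupp => /(_ d0) da.
  rewrite mxE mcoeff_mrestrict -da; case: eqP => // nj; case: nj.
  by have := congr1 (@mdeg r) mE; rewrite -mb mdegD; lia.
transitivity (0 : k).
  apply/eqP; rewrite mcoeff_eq0; apply/negP => /xhom mj.
  by rewrite mj eqxx in mb.
rewrite mxE raddf_sum big1 //= => a _; rewrite mcoeffM big1 // => -[m1 m2] /= /eqP mE.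
have [d0|d0] := eqVneq (D i a b)@_m2 0; first by rewrite d0 !mulr0.
have := D_homog (i := i) (a := a) (b := b) (m := m2).
rewrite mcoeff_msupp => /(_ d0) da.
rewrite mxE mcoeff_mrestrict -da; case: eqP => [jE|]; last by rewrite mul0r.
by case/eqP: mb; have := congr1 (@mdeg r) mE; rewrite mdegD; lia.
Qed.

Lemma homog_contr i j (w : {set 'I_r} -> 'rV_(rk i)) :
  (forall A : {set _}, homog_row #|A| j (w A)) ->
  forall A : {set _}, homog_row #|A| j (contr lt var w A).
Proof.
move=> whom A a m; rewrite mcoeff_msupp contr_mxE mcoeff_contr => nz.
have [b /andP[bA mb] wb] : exists2 b, (b \notin A) && (0 < m b)%N &
    (w (b |: A) 0 a)@_(m - U_(b)) != 0.
  apply/exists_inP; apply: contraR nz => /exists_inPn w0.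
  by rewrite big1 // => b /w0; rewrite negbK => /eqP->; rewrite mulr0.
have := whom (b |: A) a (m - U_(b))%MM.
rewrite mcoeff_msupp => /(_ wb) <-; rewrite cardsU1 bA.
have Ub : (U_(b) <= m)%MM by rewrite lep1mP -lt0n.
by rewrite -[in LHS](submK Ub) mdegD mdeg1 -!addnA (addnCA 1%N).
Qed.

(* A zigzag through [F (x) K]: lift [w] along the resolution down to [K_0], where
   the absence of generators of degree [j] makes it a Koszul boundary, and come
   back by Koszul exactness. *)
Lemma koszul_chase n i j (w : {set 'I_r} -> 'rV_(rk i)) :
  (forall A : {set _}, w A != 0 -> #|A| = n) ->
  (forall A : {set _}, homog_row #|A| j (w A)) ->
  (forall A, exists y, contr lt var w A = y *m D i) ->
  (forall N, N = (i + n)%N -> forall a : 'I_(rk N), sh a <> j) ->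
  exists2 u : {set 'I_r} -> 'rV_(rk i), u set0 = 0 &
    exists u' : {set 'I_r} -> 'rV_(rk i.+1),
      forall A, w A = contr lt var u A + u' A *m D i.
Proof.
elim: n i w => [|n IHn] i w wsize whom wlift shN.
  have w0 A : A != set0 -> w A = 0.
    move=> A0; apply/eqP; apply: contraNT A0 => /wsize/eqP.
    by rewrite cards_eq0.
  have [A|l|u u0 uE] := koszul_exact_row ltC (w := w).
  - rewrite /contr big1 // => b _; rewrite w0 ?scaler0 //.
    by apply/set0Pn; exists b; rewrite setU11.
  (* A nonzero constant term in entry [l] would force the excluded shift [sh l = j]. *)
  - apply/eqP; rewrite mcoeff_eq0; apply/negP => /whom.
    by rewrite mdeg0 cards0 addn0; apply: shN; rewrite addn0.
  - exists u => //; exists (fun=> 0) => A.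
    by rewrite mul0mx addr0 uE.
(* Homogeneous lifts of [contr lt var w], set to 0 outside Koszul degree [n], where the contraction
   vanishes. *)
have /fin_all_exists[w' w'P] (A : {set 'I_r}) : exists y : 'rV_(rk i.+1),
    [/\ homog_row #|A| j y, contr lt var w A = y *m D i & y != 0 -> #|A| = n].
  have [An|An] := eqVneq #|A| n.
    have [y yE] := wlift A.
    by have [y' ? ?] := homog_lift (homog_contr whom (A := A)) yE; exists y'.
  exists 0; split=> [a m||]; rewrite ?mxE ?msupp0 ?mul0mx ?eqxx //.
  rewrite /contr big1 // => b bA; have [->|/wsize] := eqVneq (w (b |: A)) 0.
    by rewrite scaler0.
  by rewrite cardsU1 bA add1n => -[AnE]; rewrite AnE eqxx in An.
have [A|A|A|N NE|u u0 [u' uE]] := IHn i.+1 w'.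
- by case: (w'P A).
- by case: (w'P A).
- apply/D_exact; rewrite contr_mulmx -[RHS](contr_sq ltC var w A).
  by apply: eq_contr => B; case: (w'P B).
(* The variable [N] absorbs the change from [i + n.+1] to [i.+1 + n] without a cast in the ordinal
   type. *)
- by apply: shN; rewrite NE addnS.
(* The [u' A *m D i.+1] part dies under [D i], so [w - u D] is a Koszul cycle. *)
have cE A : contr lt var w A = contr lt var (fun B => u B *m D i) A.
  case: (w'P A) => _ -> _; rewrite uE mulmxDl contr_mulmx.
  have /D_exact-> : exists y, u' A *m D i.+1 = y *m D i.+1 by exists (u' A).
  by rewrite addr0.
have [A|l|v v0 vE] := koszul_exact_row ltC (w := fun A => w A - u A *m D i).
- by rewrite contrB cE subrr.
(* Here the clause [u set0 = 0] of the induction is used: it removes the constant term on the empty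
   set. *)
- rewrite u0 mul0mx subr0; have [->|/wsize] := eqVneq (w set0) 0.
    by rewrite mxE mcoeff0.
  by rewrite cards0.
exists v => //; exists u => A; rewrite -vE.
by rewrite subrK.
Qed.

End Chase.

(** * Betti numbers of toric ideals *)

Section ToricBetti.

Variables (k : fieldType) (r N : nat) (lt : rel 'I_r).
Hypothesis ltC : forall a b, a != b -> lt a b = ~~ lt b a.
Local Notation S := {mpoly k[r]}.
Local Notation var := (fun b : 'I_r => 'X_b : S).

Variables (mon : 'I_r -> 'X_{1..N}) (tup : r.-tuple {mpoly k[N]}).
Hypothesis tupE : forall i, tnth tup i = 'X_[mon i].
Variable I : S -> Prop.
Hypothesis IE : forall p, I p <-> p \mPo tup = 0.
Variable F : minimal_resolution I.

(** Putting [S] in front turns [F] into the resolution of [S / I], with homological degrees shifted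
    up by one. *)
Definition ext_rank (i : nat) : nat := if i is i'.+1 then res_rank F i' else 1.

Definition ext_shift i : 'I_(ext_rank i) -> nat :=
  match i with 0 => fun=> 0%N | i'.+1 => @res_shift _ _ _ F i' end.

Definition ext_diff i : 'M[S]_(ext_rank i.+1, ext_rank i) :=
  match i with 0 => res_aug F | i'.+1 => res_diff F i' end.

Lemma ext_diff_homog i a b m :
  m \in msupp (ext_diff i a b) -> (mdeg m + ext_shift b)%N = ext_shift a.
Proof.
case: i a b => [|i] a b /=; last exact: res_diff_homog.
by rewrite [b]ord1 addn0; apply: res_aug_homog.
Qed.

Lemma ext_diff_exact i (x : 'rV_(ext_rank i.+1)) :
  x *m ext_diff i = 0 <-> exists y, x = y *m ext_diff i.+1.
Proof. by case: i x => [|i] x; [apply: res_exact0 | apply: res_exactS]. Qed.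

(** [set_mon] and [mnm_mon] are the multidegrees in the target ring of a Koszul generator and of a
    monomial of [S]. *)
Definition set_mon (A : {set 'I_r}) : 'X_{1..N} := (\big[+%MM/0%MM]_(b in A) mon b)%MM.
Definition mnm_mon (m : 'X_{1..r}) : 'X_{1..N} := (\big[+%MM/0%MM]_b (mon b *+ m b))%MM.

Lemma comp_tupX m : 'X_[m] \mPo tup = 'X_[mnm_mon m].
Proof.
rewrite comp_mpolyX /mnm_mon.
rewrite (big_morph (fun m => 'X_[m]) (@mpolyXD N k) (@mpolyX0 N k)).
by apply: eq_bigr => b _; rewrite tupE mpolyXn.
Qed.

Lemma comp_tupXU b : 'X_b \mPo tup = 'X_[mon b].
Proof. by rewrite comp_mpolyXU -tnth_nth tupE. Qed.

Lemma set_monU b (A : {set 'I_r}) :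
  b \notin A -> set_mon (b |: A) = (mon b + set_mon A)%MM.
Proof. by move=> bA; rewrite /set_mon big_setU1. Qed.

Lemma comp_contr (w : {set 'I_r} -> S^o) A :
  (contr lt var w A : S) \mPo tup = \sum_(b | b \notin A)
    (-1) ^+ rank_in lt b A * ('X_[mon b] * (w (b |: A) \mPo tup)).
Proof.
rewrite raddf_sum /=; apply: eq_bigr => b _.
by rewrite !rmorphM /= rmorphXn /= rmorphN rmorph1 comp_tupXU mulrA.
Qed.

(** The chain with coefficients [z A *: 'X_[zm A]] lives in multidegree [alpha]; it will be a Koszul
    cycle modulo [I], detected by the cocycle [phi]. *)
Variables (q d : nat) (alpha : 'X_{1..N}).
Variables (z phi : {set 'I_r} -> k) (zm : {set 'I_r} -> 'X_{1..r}).
Hypothesis q_gt0 : (0 < q)%N.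
Hypothesis z_supp : forall A : {set 'I_r}, z A != 0 ->
  [/\ #|A| = q, mdeg (zm A) = d & (mnm_mon (zm A) + set_mon A)%MM = alpha].
Hypothesis z_cycle : forall A, contr lt (fun=> 1) (z : {set 'I_r} -> k^o) A = 0.
Hypothesis phi_cocycle : forall G : {set 'I_r}, (set_mon G <= alpha)%MM ->
  \sum_(b in G) (-1) ^+ rank_in lt b (G :\ b) * phi (G :\ b) = 0.
Hypothesis z_phi : \sum_A phi A * z A != 0.

Definition zpoly (A : {set 'I_r}) : S := z A *: 'X_[zm A].

Lemma comp_zpoly A : (zpoly A \mPo tup) * 'X_[set_mon A] = z A *: 'X_[alpha].
Proof.
rewrite /zpoly comp_mpolyZ comp_tupX -scalerAl -mpolyXD.
by have [->|/z_supp[_ _ ->] //] := eqVneq (z A) 0; rewrite !scale0r.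
Qed.

(** Multiplying by the monomial of [set_mon A] brings every term to a scalar multiple of that of
    [alpha]; the scalars add up to the boundary of [z], and a nonzero monomial can be cancelled in a
    domain. *)
Lemma comp_contr_zpoly A : (contr lt var (zpoly : _ -> S^o) A : S) \mPo tup = 0.
Proof.
have : ((contr lt var (zpoly : _ -> S^o) A : S) \mPo tup) * 'X_[set_mon A] = 0.
  rewrite comp_contr mulr_suml.
  transitivity ((contr lt (fun=> 1) (z : _ -> k^o) A : k) *: 'X_[alpha] : {mpoly k[N]}).
    rewrite scaler_suml; apply: eq_bigr => b bA.
    rewrite -mulrA [_ * (_ \mPo _)]mulrC -mulrA -mpolyXD -set_monU // comp_zpoly.
    by apply/mpolyP => m; rewrite mulr1 mcoeff_signM !mcoeffZ mulrA.
  by rewrite z_cycle scale0r.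
move/eqP; rewrite mulf_eq0 => /orP[/eqP//|/eqP/(congr1 (mcoeff (set_mon A)))].
by rewrite mcoeffX eqxx mcoeff0 => /eqP; rewrite oner_eq0.
Qed.

(** Summation by parts moves the differential from [u] to [phi]. Sets [G] whose [set_mon G] does not
    divide [alpha] have no coefficient at [alpha], and on the others [phi] is a cocycle. *)
Lemma phi_boundary (u : {set 'I_r} -> S^o) :
  \sum_A phi A * (((contr lt var u A : S) \mPo tup) * 'X_[set_mon A])@_alpha = 0.
Proof.
pose c (G : {set 'I_r}) := ((u G \mPo tup) * 'X_[set_mon G])@_alpha.
transitivity (\sum_(A : {set _}) \sum_(b | b \notin A)
    c (b |: A) * ((-1) ^+ rank_in lt b A * phi A)).
  apply: eq_bigr => A _; rewrite comp_contr mulr_suml raddf_sum mulr_sumr /=.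
  apply: eq_bigr => b bA.
  rewrite -mulrA mcoeff_signM [_ * (_ \mPo _)]mulrC -mulrA -mpolyXD -set_monU //.
  by rewrite -/(c _); ring.
rewrite (exchange_big_dep predT) //=.
transitivity (\sum_b \sum_(G : {set 'I_r} | b \in G)
    c G * ((-1) ^+ rank_in lt b (G :\ b) * phi (G :\ b))).
  apply: eq_bigr => b _.
  rewrite (reindex_onto (fun G : {set 'I_r} => G :\ b) (fun A => b |: A)) /=.
    apply: eq_big => [G|G]; last by move=> /andP[_ /eqP->].
    rewrite !inE eqxx /=; apply/eqP/idP => [<-|/setD1K//].
    by rewrite setU11.
  by move=> A bA; rewrite setU1K.
rewrite (exchange_big_dep predT) //= big1 // => G _; rewrite -mulr_sumr.
have [leG|nleG] := boolP (set_mon G <= alpha)%MM.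
  by rewrite phi_cocycle ?mulr0.
rewrite [c G](_ : _ = 0) ?mul0r //; apply/eqP.
rewrite mcoeff_eq0 (perm_mem (msuppMX _ _)).
apply: contra nleG => /mapP[m _ ->]; exact: lem_addr.
Qed.

(** Without such a basis element the chase would make [zpoly] a Koszul boundary modulo [I], and the
    pairing of [phi] with [z] would vanish. *)
Theorem toric_shift_exists :
  exists a : 'I_(res_rank F q.-1), res_shift a = (q + d)%N.
Proof.
have [/existsP[a /eqP aE]|/existsPn none] :=
  boolP [exists a : 'I_(res_rank F q.-1), res_shift a == (q + d)%N].
  by exists a.
exfalso.
pose w (A : {set 'I_r}) : 'rV[S]_(ext_rank 0) := const_mx (zpoly A).
have wcontr A : contr lt var w A = (contr lt var (zpoly : _ -> S^o) A : S)%:M.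
  apply/rowP => l; rewrite contr_mxE [l]ord1 [RHS]mxE eqxx mulr1n.
  by apply: eq_bigr => b _; rewrite mxE.
have [A wA|A a m|A|n nE a|u _ [u' uE]] :=
  @koszul_chase k r lt ltC ext_rank ext_shift ext_diff
  ext_diff_homog ext_diff_exact q 0 (q + d) w.
- have /z_supp[] // : z A != 0.
  apply: contraNneq wA => zA; apply/eqP/rowP => l.
  by rewrite !mxE /zpoly zA scale0r.
- rewrite /w mxE mcoeff_msupp mcoeffZ mcoeffX.
  have [->|/z_supp[-> dE _]] := eqVneq (z A) 0; first by rewrite mul0r eqxx.
  by case: (zm A =P m) => [<- _|_]; rewrite ?mulr0 ?eqxx //= dE addn0 addnC.
- have /(res_aug_image F)[y yE] : I (contr lt var (zpoly : _ -> S^o) A).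
    by apply/IE; apply: comp_contr_zpoly.
  by exists y; rewrite wcontr yE.
(* As [q] is positive, [ext_rank q] is [res_rank F q.-1]. *)
- move: a; rewrite nE add0n; case: (q) q_gt0 none => // q' _ none a /eqP.
  by apply/negP; apply: none.
case/eqP: z_phi; rewrite -[RHS](phi_boundary (fun A => u A 0 0)).
apply: eq_bigr => A _; congr (_ * _).
have -> : z A = ((zpoly A \mPo tup) * 'X_[set_mon A])@_alpha.
  by rewrite comp_zpoly mcoeffZ mcoeffX eqxx mulr1.
congr (_ * _)@_ _.
have -> : zpoly A = (contr lt var u A + u' A *m ext_diff 0) 0 0.
  by rewrite -uE mxE.
rewrite mxE contr_mxE rmorphD /= [X in _ + X](_ : _ = 0) ?addr0 //.
apply/IE/(res_aug_image F); exists (u' A).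
by apply/rowP => l; rewrite [l]ord1 [RHS]mxE eqxx mulr1n.
Qed.

End ToricBetti.

(** * Cycles and cocycles on grids *)

Section RowCycle.

Variables (k : fieldType) (T : finType) (lt : rel T) (J : eqType).
Hypothesis ltC : forall a b, a != b -> lt a b = ~~ lt b a.
Variables (row : T -> J) (U : {set T}).

Definition row_weight (x : J) (b : T) : k := ((b \in U) && (row b == x))%:R.

(* The join over the rows in [rs] of the boundary of the simplex on each row. *)
Definition row_cycle (rs : seq J) : {set T} -> k^o :=
  foldr (fun x w => contr lt (row_weight x) w) (fun A => (A == U)%:R) rs.

(** A sequence, so that a row losing several cells is counted with multiplicity. *)
Definition omitted_rows (A : {set T}) : seq J := [seq row b | b <- enum (U :\: A)].

Lemma perm_omitted_rows b (A : {set T}) : b \in U -> b \notin A ->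
  perm_eq (omitted_rows A) (row b :: omitted_rows (b |: A)).
Proof.
move=> bU bA; rewrite -map_cons; apply: perm_map.
apply: uniq_perm; rewrite /= ?enum_uniq ?andbT //.
  by rewrite mem_enum !inE eqxx.
move=> c; rewrite !(mem_enum, inE) /=.
by have [->|] := eqVneq c b; rewrite ?bU ?bA // andbT.
Qed.

Lemma row_cycle_supp rs A : row_cycle rs A != 0 ->
  A \subset U /\ perm_eq (omitted_rows A) rs.
Proof.
elim: rs A => [|x rs IHrs] A /=.
  case: (A =P U) => [-> _|]; last by rewrite eqxx.
  by rewrite /omitted_rows setDv enum_set0.
move=> nz.
have [b /and3P[bA bU /eqP bx] zb] : exists2 b,
    [&& b \notin A, b \in U & row b == x] & row_cycle rs (b |: A) != 0.
  apply/exists_inP; apply: contraR nz => /exists_inPn z0.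
  rewrite /contr big1 // => b bA; rewrite /row_weight.
  have [bx|] := boolP ((b \in U) && _); last by rewrite mulr0 scale0r.
  have := z0 b; rewrite unfold_in bA bx negbK => /(_ isT)/eqP->.
  by rewrite scaler0.
have [/subsetP sbA per] := IHrs _ zb; split.
  by apply/subsetP => c cA; apply: sbA; rewrite !inE cA orbT.
by rewrite (permPl (perm_omitted_rows bU bA)) bx perm_cons.
Qed.

(** The rows being distinct, each contraction has a single nonzero term at [A], and nothing can
    cancel. *)
Lemma row_cycle_neq0 rs (A : {set T}) : uniq rs -> A \subset U ->
  perm_eq (omitted_rows A) rs -> row_cycle rs A != 0.
Proof.
elim: rs A => [|x rs IHrs] A /=.
  move=> _ sAU /perm_size/eqP; rewrite size_map -cardE cards_eq0 setD_eq0 => sUA.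
  by rewrite eqEsubset sAU sUA oner_eq0.
move=> uxrs sAU per.
have : x \in omitted_rows A by rewrite (perm_mem per) inE eqxx.
case/mapP => b; rewrite mem_enum inE => /andP[bA bU] xE.
have perb := perm_omitted_rows bU bA.
have : uniq (omitted_rows A) by rewrite (perm_uniq per).
rewrite (perm_uniq perb) /= -xE => /andP[xN _].
rewrite /contr (bigD1 b) //= big1 ?addr0.
  rewrite /row_weight bU xE eqxx mulr1 scaler_eq0 signr_eq0 /=.
  apply: IHrs; first by case/andP: uxrs.
    by rewrite subUset sub1set bU.
  by rewrite -(perm_cons x) {1}xE -(permPl perb).
move=> c /andP[cA cb]; rewrite /row_weight.
have [/andP[cU /eqP cx]|] := boolP ((c \in U) && _); last by rewrite mulr0 scale0r.
case/negP: xN; rewrite -cx; apply: map_f.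
by rewrite mem_enum !inE negb_or cb cA.
Qed.

(** The contraction anticommutes past the other rows until it meets its own copy, where the square
    is 0. *)
Lemma contr_row_cycle rs x A :
  x \in rs -> contr lt (row_weight x) (row_cycle rs) A = 0.
Proof.
elim: rs A => [|y rs IHrs] A //=; rewrite inE.
have [->|_ /= xrs] := eqVneq x y; first by rewrite contr_sq.
by rewrite (contrC ltC) contr_eq0 ?oppr0 // => B; rewrite IHrs.
Qed.

(** Each cell of [U] has exactly one row in [rs], so the full boundary is the sum of the row
    boundaries, which all vanish. *)
Lemma row_cycle_closed rs A : uniq rs -> {in U, forall b, row b \in rs} ->
  contr lt (fun=> 1) (row_cycle rs) A = 0.
Proof.
move=> urs rowU.
transitivity (\sum_(x <- rs) contr lt (row_weight x) (row_cycle rs) A).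
  rewrite exchange_big /=; apply: eq_bigr => b bA.
  have [bU|bU] := boolP (b \in U); last first.
    have [->|/row_cycle_supp[/subsetP sbA _]] := eqVneq (row_cycle rs (b |: A)) 0.
      by rewrite scaler0 big1 // => x _; rewrite scaler0.
    by rewrite sbA ?setU11 in bU.
  rewrite -scaler_suml -mulr_sumr; congr ((_ * _) *: _).
  rewrite (bigD1_seq (row b)) ?rowU //= /row_weight bU eqxx /= big1 ?addr0 //.
  by move=> x; rewrite eq_sym => /negbTE->.
by rewrite big1_seq // => x /andP[_ xrs]; rewrite contr_row_cycle.
Qed.

End RowCycle.

(** * Staircases and their flips *)

Section Staircases.

Local Open Scope nat_scope.

Variables (k : fieldType) (r t : nat) (n : 'I_t -> nat).
Variables (E : {set 'I_r}) (comp : 'I_r -> 'I_t) (ro co : 'I_r -> nat).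
Hypothesis n_gt1 : forall s, 2 <= n s.
Hypothesis cell_bound : forall b, b \in E -> ro b < n (comp b) /\ co b < n (comp b).
Hypothesis cell_inj : forall a b, a \in E -> b \in E ->
  comp a = comp b -> ro a = ro b -> co a = co b -> a = b.
Hypothesis cell_ex : forall s i j, i < n s -> j < n s ->
  exists b, [/\ b \in E, comp b = s, ro b = i & co b = j].

(* In this order the two cells exchanged by a flip of a staircase are adjacent. *)
Definition diag_lt : rel 'I_r := fun a b =>
  (comp a < comp b) || (comp a == comp b) &&
  ((ro a + co a < ro b + co b) || (ro a + co a == ro b + co b) &&
  ((ro a < ro b) || (ro a == ro b) && (a < b))).

Lemma diag_ltC a b : a != b -> diag_lt a b = ~~ diag_lt b a.
Proof. by rewrite /diag_lt -!val_eqE /=; lia. Qed.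

Definition comparable_cells a b :=
  (ro a <= ro b) && (co a <= co b) || (ro b <= ro a) && (co b <= co a).

(** Meeting each of the [2 n_s - 1] antidiagonals makes the chain in the [s]-th grid maximal. *)
Definition staircases (C : {set 'I_r}) : bool :=
  [forall a in C, [forall b in C, (comp a == comp b) ==> comparable_cells a b]]
  && [forall s, [forall d : 'I_(n s).*2.-1,
       [exists a in C, (comp a == s) && (ro a + co a == d)]]].

Lemma staircasesP (C : {set _}) : reflect
  ((forall a b, a \in C -> b \in C -> comp a = comp b -> comparable_cells a b) /\
   (forall s d, d < (n s).*2.-1 ->
      exists a, [/\ a \in C, comp a = s & ro a + co a = d]))
  (staircases C).
Proof.
apply: (iffP andP) => -[chain full]; split.
- move=> a b aC bC ab; move/forall_inP/(_ a aC)/forall_inP/(_ b bC): chain.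
  by rewrite ab eqxx.
- move=> s d ds; move/forallP/(_ s)/forallP/(_ (Ordinal ds)): full.
  by case/exists_inP => a aC /andP[/eqP ? /eqP ?]; exists a.
- apply/forall_inP => a aC; apply/forall_inP => b bC; apply/implyP => /eqP.
  exact: chain.
- apply/forallP => s; apply/forallP => d; have [a [aC sE dE]] := full s d (ltn_ord d).
  by apply/exists_inP; exists a; rewrite // sE dE !eqxx.
Qed.

(** For the complement of a face: the face contains no full row and no full column. *)
Definition covers_lines (D : {set 'I_r}) :=
  (forall s i, i < n s -> exists b, [/\ b \in D, comp b = s & ro b = i]) /\
  (forall s j, j < n s -> exists b, [/\ b \in D, comp b = s & co b = j]).

(** Since [D] still meets the row and the column of [e], the staircase turns at [e], and [e'] is the
    opposite corner of the unit square at that turn. *)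
Lemma staircase_flip (D : {set 'I_r}) e :
  D \subset E -> e \in E -> e \notin D -> covers_lines D -> staircases (e |: D) ->
  exists e', [/\ [/\ e' \in E, e' \notin D & staircases (e' |: D)],
    [/\ comp e' = comp e, ro e' + co e' = ro e + co e &
        ro e' = (ro e).+1 \/ ro e = (ro e').+1] &
    forall b, b \in E -> b \notin D -> staircases (b |: D) -> b = e \/ b = e'].
Proof.
move=> /subsetP sDE eE eD [rowD colD] /staircasesP[chain full].
set s := comp e; have [] := cell_bound eE; rewrite -/s => re ce.
have n2 := n_gt1 s.
have chainD a b : a \in D -> b \in D -> comp a = comp b -> comparable_cells a b.
  by move=> aD bD; apply: chain; rewrite !inE ?aD ?bD orbT.
have chaine a : a \in D -> comp a = s -> comparable_cells a e.
  by move=> aD; apply: chain; rewrite !inE ?aD ?eqxx ?orbT.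
have neq a : a \in D -> comp a = s -> ro a = ro e -> co a = co e -> False.
  move=> aD sE rE cE; move: eD; rewrite -(cell_inj (sDE _ aD) eE sE rE cE).
  by rewrite aD.
(* [e] is neither end of the staircase: comparable cells of [D] in the first row and first column
   would include the corner itself, and likewise for the last ones. *)
have [d0 dn] : 0 < ro e + co e /\ (ro e + co e).+1 < (n s).*2.-1.
  have [x [xD xs xi]] := rowD s 0 ltac:(lia).
  have [y [yD ys yj]] := colD s 0 ltac:(lia).
  have [x' [x'D x's x'i]] := rowD s (n s).-1 ltac:(lia).
  have [y' [y'D y's y'j]] := colD s (n s).-1 ltac:(lia).
  have := chainD _ _ xD yD (etrans xs (esym ys)).
  have := chainD _ _ x'D y'D (etrans x's (esym y's)).
  have := neq x xD xs; have := neq y yD ys.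
  have := neq x' x'D x's; have := neq y' y'D y's.
  have := cell_bound (sDE _ x'D); have := cell_bound (sDE _ y'D).
  rewrite x's y's /comparable_cells; lia.
have inD a d : a \in e |: D -> ro a + co a = d -> d <> ro e + co e -> a \in D.
  by rewrite !inE => /predU1P[->|//] ->.
have [a [aeD sa da]] := full s (ro e + co e).-1 ltac:(lia).
have [c [ceD sc dc]] := full s (ro e + co e).+1 dn.
have aD : a \in D by apply: inD aeD da _; lia.
have cD : c \in D by apply: inD ceD dc _; lia.
have [ra_e ca_e] : ro a <= ro e /\ co a <= co e.
  by have := chaine a aD sa; rewrite /comparable_cells; lia.
have [re_c ce_c] : ro e <= ro c /\ co e <= co c.
  by have := chaine c cD sc; rewrite /comparable_cells; lia.
have [] := cell_bound (sDE _ aD); have [] := cell_bound (sDE _ cD).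
rewrite sa sc => rc cc ra ca.
(* If the neighbours [a] and [c] were aligned with [e], the cell of [D] on the perpendicular line
   through [e] could not be comparable with both. *)
have turn : (ro a = ro e /\ ro c = (ro e).+1) \/ (ro e = (ro a).+1 /\ ro c = ro e).
  have [x [xD xs xi]] := rowD s _ re; have [y [yD ys yj]] := colD s _ ce.
  have nx : co x <> co e by exact: neq xi.
  have ny : ro y <> ro e by move=> yi; exact: neq yi yj.
  have ya := chainD _ _ yD aD (etrans ys (esym sa)).
  have yc := chainD _ _ yD cD (etrans ys (esym sc)).
  have : ro c <> ro a by move: ya yc; rewrite /comparable_cells; lia.
  clear ya yc; have xa := chainD _ _ xD aD (etrans xs (esym sa)).
  have xc := chainD _ _ xD cD (etrans xs (esym sc)).
  have : co c <> co a by move: xa xc; rewrite /comparable_cells; lia.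
  by clear -re_c ce_c ra_e ca_e da dc d0; lia.
(* The reflection of [e] in the middle of [a] and [c]. *)
have [e' [e'E se' re' ce']] : exists e', [/\ e' \in E, comp e' = s,
    ro e' = ro a + ro c - ro e & co e' = co a + co c - co e].
  by apply: cell_ex; lia.
have rce' : ro e' + co e' = ro e + co e.
  by lia.
have ree' : ro e' = (ro e).+1 \/ ro e = (ro e').+1 by lia.
exists e'; split.
- split=> //.
    apply/negP => e'D; have := chaine _ e'D se'.
    by rewrite /comparable_cells; lia.
  have chaine' b : b \in D -> comp b = s -> comparable_cells b e'.
    move=> bD sb; have := chaine _ bD sb.
    have := chainD _ _ bD aD (etrans sb (esym sa)).
    have := chainD _ _ bD cD (etrans sb (esym sc)).
    have nb := neq b bD sb.
    clear -nb turn da dc d0 re' ce'; rewrite /comparable_cells; lia.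
  apply/staircasesP; split.
    move=> b b'; rewrite !inE => /predU1P[->|bD] /predU1P[->|b'D] sbb'.
    + by rewrite /comparable_cells; lia.
    + have := chaine' b' b'D; rewrite -sbb' se' => /(_ erefl).
      by rewrite /comparable_cells; lia.
    + by apply: chaine'; rewrite // sbb'.
    + exact: chainD.
  move=> s' d ds; have [b [beD sb db]] := full s' d ds.
  move: beD; rewrite !inE => /predU1P[bE|bD].
    exists e'; rewrite !inE eqxx; split=> //; first by rewrite se' -sb bE.
    by rewrite rce' -db bE.
  by exists b; rewrite !inE bD orbT.
- by split.
move=> b bE bD /staircasesP[chainb fullb].
(* [D] has no cell on the antidiagonal of [e], so [b] is there; lying between [a] and [c] leaves two
   positions. *)
have [b' [b'bD sb' db']] := fullb s (ro e + co e) (ltnW dn).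
have bb' : b' = b.
  move: b'bD; rewrite !inE => /predU1P[//|b'D].
  have nb' := neq b' b'D sb'; have := chaine _ b'D sb'.
  by clear -nb' db'; rewrite /comparable_cells; lia.
rewrite bb' {b' b'bD bb'} in sb' db'.
have ba : comparable_cells b a.
  by apply: chainb; rewrite ?inE ?eqxx ?aD ?orbT // sb'.
have bc : comparable_cells b c.
  by apply: chainb; rewrite ?inE ?eqxx ?cD ?orbT // sb'.
have [rbe|rbe'] : ro b = ro e \/ ro b = ro e'.
- clear -ba bc db' turn da dc d0 re'; move: ba bc; rewrite /comparable_cells; lia.
- left; apply: cell_inj => //; clear -rbe db'; lia.
- right; apply: cell_inj; rewrite ?se' //; clear -rbe' db' rce'; lia.
Qed.

(** No cell of [G] lies strictly between [e] and [e'] in [diag_lt], so the two signs are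
    opposite. *)
Lemma rank_in_flip (G : {set 'I_r}) e e' : G \subset E -> e \in G -> e' \in G ->
  comp e' = comp e -> ro e' + co e' = ro e + co e -> ro e' = (ro e).+1 ->
  rank_in diag_lt e' (G :\ e') = (rank_in diag_lt e (G :\ e)).+1.
Proof.
move=> /subsetP sGE eG e'G ce de re.
rewrite /rank_in.
have -> : [set a in G :\ e' | diag_lt a e'] = e |: [set a in G :\ e | diag_lt a e].
  apply/setP => a; rewrite !inE.
  have [->|ae] := eqVneq a e.
    have ee' : e != e' by apply/eqP => ee'; move: re; rewrite -ee'; lia.
    by rewrite eG ee' /diag_lt ce de re !eqxx !ltnn ltnSn.
  have [->|ae'] := eqVneq a e'.
    by rewrite e'G /diag_lt ce de re; lia.
  rewrite /=; case: (boolP (a \in G)) => //= aG.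
  have := cell_inj (sGE _ aG) (sGE _ eG); have := cell_inj (sGE _ aG) (sGE _ e'G).
  move=> h' h; rewrite /diag_lt ce de re.
  have [sa|//] := eqVneq (comp a) (comp e); rewrite sa ltnn /=.
  have nh : ro a + co a = ro e + co e -> ro a <> ro e.
    by move=> h1 h2; move: ae; rewrite h ?eqxx //; lia.
  have nh' : ro a + co a = ro e + co e -> ro a <> (ro e).+1.
    by move=> h1 h2; move: ae'; rewrite h' ?eqxx // ?ce ?re //; lia.
  by lia.
by rewrite cardsU1 !inE eqxx.
Qed.

Definition stair_cochain (A : {set 'I_r}) : k :=
  ((A \subset E) && staircases (E :\: A))%:R%R.

Lemma stair_cochainD1 (G : {set 'I_r}) b : G \subset E -> b \in G ->
  stair_cochain (G :\ b) = (staircases (b |: (E :\: G)))%:R%R.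
Proof.
move=> sGE bG; rewrite /stair_cochain (subset_trans (subD1set _ _) sGE) /=.
congr (staircases _)%:R%R; apply/setP => a; rewrite !inE.
by have [->|] := eqVneq a b; rewrite // (subsetP sGE).
Qed.

(** Either no term is nonzero, or exactly two are, exchanged by a flip and of opposite signs. *)
Lemma stair_cocycle (G : {set 'I_r}) : G \subset E -> covers_lines (E :\: G) ->
  (\sum_(b in G) (-1) ^+ rank_in diag_lt b (G :\ b) * stair_cochain (G :\ b) = 0)%R.
Proof.
move=> sGE cov.
have phiE b : b \in G -> stair_cochain (G :\ b) = (staircases (b |: (E :\: G)))%:R%R.
  exact: stair_cochainD1.
have [/existsP[e /andP[eG st]]|/existsPn none] :=
    boolP [exists e, (e \in G) && staircases (e |: (E :\: G))]; last first.
  rewrite big1 // => b bG; have := none b; rewrite phiE // bG /= => /negbTE->.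
  by rewrite mulr0.
have inDN b : b \in G -> b \notin E :\: G by rewrite inE => ->.
have [e' [[e'E e'D st'] [ce de re] uniq_e]] :=
  staircase_flip (subsetDl E G) (subsetP sGE _ eG) (inDN _ eG) cov st.
have e'G : e' \in G by move: e'D; rewrite inE e'E andbT negbK.
have ee' : e' != e by apply/eqP => ee'; move: re; rewrite ee'; lia.
rewrite (bigD1 e) //= (bigD1 e') ?e'G //= big1 ?addr0; last first.
  move=> b /andP[/andP[bG be] be']; rewrite phiE //.
  case: (boolP (staircases _)) => [stb|_]; last by rewrite mulr0.
  have [bE|bE] := uniq_e b (subsetP sGE _ bG) (inDN _ bG) stb.
    by rewrite bE eqxx in be.
  by rewrite bE eqxx in be'.
rewrite !phiE // st st' !mulr1.
case: re => re.
  by rewrite (rank_in_flip sGE eG e'G ce de re) exprS mulN1r subrr.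
by rewrite (rank_in_flip sGE e'G eG) // exprS mulN1r addrC subrr.
Qed.

Definition upper_cells : {set 'I_r} := [set b in E | (ro b).+1 < n (comp b)].

Definition row_of (b : 'I_r) : 'I_t * nat := (comp b, ro b).

Definition row_list : seq ('I_t * nat) :=
  [seq (s, i) | s <- enum 'I_t, i <- iota 0 (n s).-1].

Lemma row_list_uniq : uniq row_list.
Proof.
apply: allpairs_uniq_dep; rewrite ?enum_uniq //; first by move=> s _; exact: iota_uniq.
by move=> [s i] [s' i'] _ _ /= [-> ->].
Qed.

Lemma mem_row_list s i : ((s, i) \in row_list) = (i.+1 < n s).
Proof.
have n2 := n_gt1 s.
apply/allpairsPdep/idP => [[s' [i' [_ + [-> ->]]]]|lt_i].
  by rewrite mem_iota; have := n_gt1 s'; lia.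
by exists s, i; rewrite mem_enum mem_iota; split=> //; lia.
Qed.

Lemma size_row_list : size row_list = \sum_s (n s).-1.
Proof.
rewrite size_allpairs_dep sumnE big_map big_enum.
by apply: eq_bigr => s _; rewrite size_iota.
Qed.

Definition grid_cycle : {set 'I_r} -> k :=
  row_cycle k diag_lt row_of upper_cells row_list.

(** Its complement in [E] is the first column and last row of each grid: the staircase where cycle
    and cocycle meet. *)
Definition hook_face : {set 'I_r} := [set b in upper_cells | 0 < co b].

Lemma grid_cycle_hook : grid_cycle hook_face != 0%R.
Proof.
apply: row_cycle_neq0; first exact: row_list_uniq.
  by apply/subsetP => b; rewrite inE => /andP[].
have memO b : (b \in upper_cells :\: hook_face) = (b \in upper_cells) && (co b == 0).
  by rewrite !inE; lia.
apply: uniq_perm; last 1 first.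
- move=> [s i]; rewrite mem_row_list; apply/mapP/idP => [[b]|lt_i].
    by rewrite mem_enum memO inE => /andP[/andP[_ ?] _] [-> ->].
  have [b [bE bs bi bj]] := @cell_ex s i 0 ltac:(lia) ltac:(lia).
  by exists b; rewrite ?mem_enum ?memO ?inE /row_of ?bE bs bi ?lt_i ?bj.
- rewrite map_inj_in_uniq ?enum_uniq // => a b; rewrite !mem_enum !memO !inE.
  move=> /andP[/andP[aE _] /eqP a0] /andP[/andP[bE _] /eqP b0] [ab abr].
  by apply: cell_inj => //; rewrite a0 b0.
- exact: row_list_uniq.
Qed.

Lemma stair_cochain_hook : stair_cochain hook_face = 1%R.
Proof.
have -> : stair_cochain hook_face = (true)%:R%R => //.
congr (_%:R)%R; congr nat_of_bool.
apply/andP; split; first by apply/subsetP => b; rewrite !inE => /andP[/andP[]].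
have memC b : (b \in E :\: hook_face) = (b \in E) && (((ro b).+1 == n (comp b)) || (co b == 0)).
  rewrite !inE; case: (boolP (b \in E)) => bE; rewrite ?andbF //=.
  by have [] := cell_bound bE; lia.
apply/staircasesP; split=> [a b|s d ds].
  rewrite !memC => /andP[aE ac] /andP[bE bc] ab.
  have [] := cell_bound aE; have [] := cell_bound bE; rewrite /comparable_cells.
  by move: ac bc; rewrite ab; lia.
have n2 := n_gt1 s.
(* The first column meets the antidiagonals [d < n s], the last row the others. *)
have [dn|dn] := ltnP d (n s).
  have [b [bE bs bi bj]] := @cell_ex s d 0 dn ltac:(lia).
  by exists b; rewrite memC bE bj bi orbT addn0.
have [b [bE bs bi bj]] := @cell_ex s (n s).-1 (d - (n s).-1) ltac:(lia) ltac:(lia).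
exists b; rewrite memC bE bs bi bj; split=> //; lia.
Qed.

(* The last row lies in the complement of every face of the cycle, so that a
   staircase containing it first runs down the first column. *)
Lemma stair_grid_pairing : (\sum_A stair_cochain A * grid_cycle A != 0)%R.
Proof.
rewrite (bigD1 hook_face) //= big1 ?addr0 => [|A AF].
  by rewrite stair_cochain_hook mul1r grid_cycle_hook.
have [->|/row_cycle_supp[sAU per]] := eqVneq (grid_cycle A) 0%R.
  by rewrite mulr0.
rewrite /stair_cochain; case: (boolP (_ && _)) => [/andP[sAE st]|]; last by rewrite mul0r.
case/eqP: AF; move/staircasesP: st => [chain _].
(* The corner at the foot of the first column is outside [A], and an upper cell is comparable with
   it only in that column. *)
have colA b : b \in upper_cells -> b \notin A -> co b = 0.
  rewrite inE => /andP[bE lt_b] bA; have n2 := n_gt1 (comp b).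
  have [c [cE cs ci cj]] := @cell_ex (comp b) (n (comp b)).-1 0 ltac:(lia) ltac:(lia).
  have cA : c \notin A.
    by apply/negP => /(subsetP sAU); rewrite inE cs ci; lia.
  have := chain b c; rewrite !inE bA bE cA cE => /(_ isT isT (esym cs)).
  by rewrite /comparable_cells; lia.
apply/setP => b; rewrite inE; apply/idP/idP => [bA|/andP[bU b0]].
  (* The row of [b] omits some cell, which by [colA] is in the first column and hence would be
     [b]. *)
  have bU := subsetP sAU _ bA; rewrite bU /= lt0n; apply/eqP => b0.
  have : row_of b \in row_list by move: bU; rewrite mem_row_list inE => /andP[].
  rewrite -(perm_mem per) => /mapP[c]; rewrite mem_enum inE => /andP[cA cU].
  move=> [bc bcr]; have c0 := colA c cU cA.
  move: cU bU; rewrite !inE => /andP[cE _] /andP[bE _].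
  by move: cA; rewrite -(cell_inj bE cE bc bcr) ?bA // b0.
by apply/negPn/negP => /(colA b bU) bc; rewrite bc in b0.
Qed.

End Staircases.

(** * Multidegrees of grid faces *)

Lemma card_inj_bound (T : finType) (X : {set T}) (h : T -> nat) m :
  {in X &, injective h} -> {in X, forall b, (h b < m)%N} -> (#|X| <= m)%N.
Proof.
move=> hinj hm; rewrite cardE -(size_map h) -[m in X in (_ <= X)%N](size_iota 0 m).
apply: uniq_leq_size => [|_ /mapP[b + ->]].
  by rewrite map_inj_in_uniq ?enum_uniq // => a b; rewrite !mem_enum; apply: hinj.
by rewrite mem_enum mem_iota => /hm.
Qed.

Section GridDegree.

Local Open Scope nat_scope.

Variables (k : fieldType) (r N t : nat) (n : 'I_t -> nat).
Variables (E : {set 'I_r}) (comp : 'I_r -> 'I_t) (ro co : 'I_r -> nat).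
Hypothesis n_gt1 : forall s, 2 <= n s.
Hypothesis cell_bound : forall b, b \in E -> ro b < n (comp b) /\ co b < n (comp b).
Hypothesis cell_inj : forall a b, a \in E -> b \in E ->
  comp a = comp b -> ro a = ro b -> co a = co b -> a = b.
Hypothesis cell_ex : forall s i j, i < n s -> j < n s ->
  exists b, [/\ b \in E, comp b = s, ro b = i & co b = j].

Variables (mon : 'I_r -> 'X_{1..N}) (rv cv : 'I_t -> nat -> 'I_N).
Hypothesis rv_inj : forall s s' i i', i < n s -> i' < n s' ->
  rv s i = rv s' i' -> s = s' /\ i = i'.
Hypothesis cv_inj : forall s s' i i', i < n s -> i' < n s' ->
  cv s i = cv s' i' -> s = s' /\ i = i'.
Hypothesis rv_cv : forall s s' i i', i < n s -> i' < n s' -> rv s i <> cv s' i'.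
Hypothesis mon_cell : forall b, b \in E ->
  mon b = (U_(rv (comp b) (ro b)) + U_(cv (comp b) (co b)))%MM.
Hypothesis mon_other : forall b, b \notin E -> exists2 v, 0 < mon b v &
  forall s i, i < n s -> v <> rv s i /\ v <> cv s i.

Local Notation U := (upper_cells n E comp ro).
Local Notation hook := (hook_face n E comp ro co).
Local Notation rows := (row_list n).
Local Notation cyc := (grid_cycle k n E comp ro co).

(** The default [b] is never reached for [b] in [E]. *)
Definition last_cell (b : 'I_r) : 'I_r :=
  odflt b [pick c in E | [&& comp c == comp b, ro c == (n (comp b)).-1 & co c == co b]].

Lemma last_cellP b : b \in E -> [/\ last_cell b \in E, comp (last_cell b) = comp b,
  ro (last_cell b) = (n (comp b)).-1 & co (last_cell b) = co b].
Proof.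
move=> bE; rewrite /last_cell; case: pickP => [c /and4P[cE /eqP ? /eqP ? /eqP ?]|none].
  by split.
have [_ cb] := cell_bound bE; have n2 := n_gt1 (comp b).
have [c [cE cs ci cj]] := @cell_ex (comp b) (n (comp b)).-1 (co b) ltac:(lia) cb.
by have := none c; rewrite cE cs ci cj !eqxx.
Qed.

(* The monomial that completes a face [A] of the cycle to degree [alpha]. *)
Definition residue (A : {set 'I_r}) : 'X_{1..r} :=
  (\big[+%MM/0%MM]_(b in U :\: A) U_(last_cell b))%MM.

Lemma mnm_mon_residue A :
  mnm_mon mon (residue A) = (\big[+%MM/0%MM]_(b in U :\: A) mon (last_cell b))%MM.
Proof.
have mnm_monD m m' : mnm_mon mon (m + m') = (mnm_mon mon m + mnm_mon mon m')%MM.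
  rewrite /mnm_mon -big_split; apply: eq_bigr => b _ /=.
  by apply/mnmP => v; rewrite !(mnmDE, mulmnE) mulnDr.
have mnm_mon0 : mnm_mon mon 0%MM = 0%MM.
  by rewrite /mnm_mon big1 // => b _; rewrite mnm0E.
rewrite /residue (big_morph _ mnm_monD mnm_mon0); apply: eq_bigr => b _.
rewrite /mnm_mon (bigD1 (last_cell b)) //= mnm1E eqxx big1 ?addm0 // => c.
by rewrite mnm1E eq_sym => /negbTE->.
Qed.

(* Takes the value [n s - 1] on every [rv s i] and [cv s i], and [0] elsewhere. *)
Definition alpha : 'X_{1..N} := (mnm_mon mon (residue hook) + set_mon mon hook)%MM.

Lemma upper_sub b : b \in U -> b \in E.
Proof. by rewrite inE => /andP[]. Qed.

(** Replacing an omitted cell by the last one of its column keeps the column vertex and only moves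
    the row vertex, so the degree depends on the omitted rows alone. The row terms are added on the
    left to avoid subtracting monomials. *)
Lemma residue_degree (A : {set 'I_r}) :
  A \subset U -> perm_eq (omitted_rows (row_of comp ro) U A) rows ->
  (mnm_mon mon (residue A) + set_mon mon A + \big[+%MM/0]_(x <- rows) U_(rv x.1 x.2)
   = \big[+%MM/0]_(x <- rows) U_(rv x.1 (n x.1).-1) + \big[+%MM/0]_(b in U) mon b)%MM.
Proof.
move=> sAU per.
have sumO (h : 'I_t * nat -> 'X_{1..N}) : (\big[+%MM/0]_(x <- rows) h x)%MM =
    (\big[+%MM/0]_(b in U :\: A) h (row_of comp ro b))%MM.
  by rewrite -(perm_big _ per) big_map big_enum.
have -> : (\big[+%MM/0]_(b in U) mon b
    = set_mon mon A + \big[+%MM/0]_(b in U :\: A) mon b)%MM.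
  by rewrite (big_setID A) /= (setIidPr sAU).
rewrite !sumO mnm_mon_residue (addmC _ (set_mon mon A)) -addmA.
rewrite [RHS]addmC -[RHS]addmA; congr (_ + _)%MM.
rewrite -!big_split /=; apply: eq_bigr => b; rewrite inE => /andP[_ /upper_sub bE].
have [lE lc lr lco] := last_cellP bE; rewrite !mon_cell // lc lr lco.
by apply/mnmP => v; rewrite !mnmDE /row_of /=; lia.
Qed.

Lemma grid_cycle_degree A : cyc A != 0%R ->
  [/\ #|A| = #|U| - size rows, mdeg (residue A) = size rows &
      (mnm_mon mon (residue A) + set_mon mon A)%MM = alpha].
Proof.
move=> /row_cycle_supp[sAU per].
have cardO : #|U :\: A| = size rows.
  by rewrite -(perm_size per) size_map -cardE.
split.
- have := cardsID A U; rewrite (setIidPr sAU) cardO => <-.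
  by rewrite addnK.
- rewrite /residue mdeg_sum -cardO -sum1_card; apply: eq_bigr => b _.
  by rewrite mdeg1.
(* After adding the row vertices, [A] and the hook have the same degree. *)
apply: (@addIm _ (\big[+%MM/0%MM]_(x <- rows) U_(rv x.1 x.2))%MM).
have /row_cycle_supp[sHU perH] := grid_cycle_hook k n_gt1 cell_inj cell_ex.
by rewrite residue_degree // residue_degree.
Qed.

(** The row and column vertices of a cell differ, so its exponents are 0 or 1 and degrees count
    cells. *)
Lemma alpha_count v :
  alpha v = #|[set b in U :\: hook | 0 < mon (last_cell b) v]|
            + #|[set b in hook | 0 < mon b v]|.
Proof.
have le1 b : b \in E -> mon b v = (0 < mon b v) :> nat.
  move=> bE; have [rb cb] := cell_bound bE; rewrite mon_cell // mnmDE !mnm1E.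
  have := rv_cv rb cb.
  by case: (rv _ _ =P v) => [->|_]; case: (cv _ _ =P v) => [->|_].
rewrite mnmDE mnm_mon_residue /set_mon !mnm_sumE; congr (_ + _).
  rewrite -sum1_card big_mkcond [RHS]big_mkcond /=; apply: eq_bigr => b _.
  rewrite !inE; case: ifP => //= /andP[_ /andP[bE _]].
  by have [lE _ _ _] := last_cellP bE; rewrite le1 //; case: ltnP.
rewrite -sum1_card big_mkcond [RHS]big_mkcond /=; apply: eq_bigr => b _.
rewrite !inE; case: ifP => //= /andP[/andP[bE _] _].
by rewrite le1 //; case: ltnP.
Qed.

Lemma mon_gt0_row b s i : b \in E -> i < n s ->
  (0 < mon b (rv s i)) = (comp b == s) && (ro b == i).
Proof.
move=> bE lti; have [rb cb] := cell_bound bE; rewrite mon_cell // mnmDE !mnm1E.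
have -> : (cv (comp b) (co b) == rv s i) = false.
  by apply/eqP => /esym; apply: rv_cv.
rewrite addn0; apply/idP/andP => [|[/eqP-> /eqP->]]; last by rewrite eqxx.
by case: eqP => // /rv_inj[] // -> ->.
Qed.

Lemma mon_gt0_col b s j : b \in E -> j < n s ->
  (0 < mon b (cv s j)) = (comp b == s) && (co b == j).
Proof.
move=> bE ltj; have [rb cb] := cell_bound bE; rewrite mon_cell // mnmDE !mnm1E.
have -> : (rv (comp b) (ro b) == cv s j) = false by apply/eqP; apply: rv_cv.
rewrite add0n; apply/idP/andP => [|[/eqP-> /eqP->]]; last by rewrite eqxx.
by case: eqP => // /cv_inj[] // -> ->.
Qed.

Lemma alpha_row s i : i < n s -> alpha (rv s i) < n s.
Proof.
move=> lti; have n2 := n_gt1 s; rewrite alpha_count -[n s]prednK ?ltnS; last by lia.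
(* The last row receives only the residue, one cell per upper row; any other row receives only the
   hook, one cell per positive column. *)
have [il|il] := eqVneq i (n s).-1.
  have -> : #|[set b in hook | 0 < mon b (rv s i)]| = 0.
    apply/eqP; rewrite cards_eq0; apply/eqP/setP => b; rewrite !inE.
    apply/negbTE/negP => /andP[/andP[/andP[bE bU] _]].
    by rewrite mon_gt0_row // => /andP[/eqP bs /eqP bi]; move: bU; rewrite bs; lia.
  rewrite addn0.
  apply: (card_inj_bound (h := ro)) => [a b|b]; rewrite !inE.
    move=> /andP[/andP[/nandP an /andP[aE aU]] am] /andP[/andP[/nandP bn /andP[bE bU]] bm].
    have [alE ac _ _] := last_cellP aE; have [blE bc _ _] := last_cellP bE.
    move: am bm; rewrite !mon_gt0_row // ac bc => /andP[/eqP as_ _] /andP[/eqP bs _] rab.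
    apply: cell_inj => //; first by rewrite as_ bs.
    by move: an bn; rewrite aE aU bE bU => -[//|an] [//|bn]; lia.
  move=> /andP[/andP[_ /andP[bE bU]] bm].
  have [blE bc _ _] := last_cellP bE.
  by move: bm bU; rewrite mon_gt0_row // bc => /andP[/eqP -> _]; lia.
have -> : #|[set b in U :\: hook | 0 < mon (last_cell b) (rv s i)]| = 0.
  apply/eqP; rewrite cards_eq0; apply/eqP/setP => b; rewrite !inE.
  apply/negbTE/negP => /andP[/andP[_ /andP[bE bU]]].
  have [blE bc br _] := last_cellP bE; rewrite mon_gt0_row // bc br.
  by move=> /andP[/eqP bs /eqP bi]; move: il; rewrite -bi bs eqxx.
rewrite add0n; apply: (card_inj_bound (h := fun b => (co b).-1)) => [a b|b]; rewrite !inE.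
  move=> /andP[/andP[/andP[aE aU] a0] am] /andP[/andP[/andP[bE bU] b0] bm].
  move: am bm; rewrite !mon_gt0_row // => /andP[/eqP as_ /eqP ai] /andP[/eqP bs /eqP bi] cab.
  by apply: cell_inj; rewrite // ?as_ ?bs ?ai ?bi //; lia.
move=> /andP[/andP[/andP[bE bU] b0]]; rewrite mon_gt0_row // => /andP[/eqP bs _].
by have [_] := cell_bound bE; rewrite bs; lia.
Qed.

Lemma alpha_col s j : j < n s -> alpha (cv s j) < n s.
Proof.
move=> ltj; have n2 := n_gt1 s; rewrite alpha_count -[n s]prednK ?ltnS; last by lia.
(* [last_cell] keeps the column, so both counts together run over the upper cells of column [j]. *)
have -> : #|[set b in U :\: hook | 0 < mon (last_cell b) (cv s j)]|
    + #|[set b in hook | 0 < mon b (cv s j)]|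
    = #|[set b in U | (comp b == s) && (co b == j)]|.
  rewrite -(cardsID hook [set b in U | _]) addnC; congr (_ + _); apply: eq_card => b; rewrite !inE.
    case: (boolP (b \in E)) => //= bE; rewrite mon_gt0_col //.
    by case: (_.+1 < _); rewrite ?andbF //= andbC.
  case: (boolP (b \in E)) => bE /=; last by [].
  have [blE bc _ bj] := last_cellP bE; rewrite mon_gt0_col // bc bj.
  by rewrite -!andbA.
apply: (card_inj_bound (h := ro)) => [a b|b]; rewrite !inE.
  move=> /andP[/andP[aE aU] /andP[/eqP as_ /eqP aj]] /andP[/andP[bE bU] /andP[/eqP bs /eqP bj]] rab.
  by apply: cell_inj; rewrite // ?as_ ?bs ?aj ?bj.
by move=> /andP[/andP[bE bU] /andP[/eqP bs _]]; move: bU; rewrite bs; lia.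
Qed.

Lemma alpha_other v :
  (forall s i, i < n s -> v <> rv s i /\ v <> cv s i) -> alpha v = 0.
Proof.
move=> vN; have mon0 b : b \in E -> (0 < mon b v) = false.
  move=> bE; have [rb cb] := cell_bound bE; rewrite mon_cell // mnmDE !mnm1E.
  have [nr _] := vN _ _ rb; have [_ nc] := vN _ _ cb.
  by case: eqP => [/esym|_] //; case: eqP => [/esym|].
rewrite alpha_count; apply/eqP; rewrite addn_eq0 !cards_eq0.
apply/andP; split; apply/eqP/setP => b; rewrite !inE; apply/negbTE/negP.
  by case/andP=> /andP[_ /andP[bE _]]; have [lE _ _ _] := last_cellP bE; rewrite mon0.
by case/andP=> /andP[/andP[bE _] _]; rewrite mon0.
Qed.

Lemma set_mon_count (G : {set 'I_r}) v : #|[set b in G | 0 < mon b v]| <= set_mon mon G v.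
Proof.
rewrite /set_mon mnm_sumE -sum1_card big_mkcond [X in _ <= X]big_mkcond /=.
by apply: leq_sum => b _; rewrite inE; case: (b \in G) => //=; case: ltnP.
Qed.

(** An edge outside [E] has a vertex where [alpha] is 0, and a full line of the [s]-th grid would
    contribute [n s] at a vertex where [alpha] is smaller. *)
Lemma degree_covers (G : {set 'I_r}) : (set_mon mon G <= alpha)%MM ->
  G \subset E /\ covers_lines n comp ro co (E :\: G).
Proof.
move=> /mnm_lepP leG.
have cnt v m : alpha v < m -> #|[set b in G | 0 < mon b v]| < m.
  by move=> lt_m; rewrite (leq_ltn_trans (set_mon_count G v)) // (leq_ltn_trans (leG v)).
have line s v (e : 'I_(n s) -> 'I_r) : alpha v < n s -> injective e ->
    (forall i, e i \in E /\ 0 < mon (e i) v) -> exists i, e i \in E :\: G.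
  move=> lt_v e_inj eP; apply/existsP; apply: contraTT (cnt v _ lt_v) => /existsPn nG.
  rewrite -leqNgt -[n s in X in X <= _]card_ord -(card_imset _ e_inj).
  apply/subset_leq_card/subsetP => _ /imsetP[i _ ->]; have [eE em] := eP i.
  by have := nG i; rewrite !inE eE andbT negbK => ->.
split.
  apply/subsetP => b bG; apply/negPn/negP => /mon_other[v bv /alpha_other a0].
  have := cnt v 1; rewrite a0 => /(_ isT); rewrite ltnS leqn0 cards_eq0.
  by move/eqP/setP/(_ b); rewrite !inE bG bv.
split=> [s i lti|s j ltj].
  have /fin_all_exists[e eP] (j : 'I_(n s)) := cell_ex lti (ltn_ord j).
  have [||j|j] := line s (rv s i) e; first exact: alpha_row.
  - move=> j j' ee'; apply: val_inj; case: (eP j) => _ _ _ /= <-.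
    by case: (eP j') => _ _ _ <-; rewrite ee'.
  - by case: (eP j) => eE es ei _; rewrite mon_gt0_row // es ei !eqxx.
  by move=> eD; exists (e j); case: (eP j).
have /fin_all_exists[e eP] (i : 'I_(n s)) := cell_ex (ltn_ord i) ltj.
have [||i|i] := line s (cv s j) e; first exact: alpha_col.
- move=> i i' ee'; apply: val_inj; case: (eP i) => _ _ /= <- _.
  by case: (eP i') => _ _ <- _; rewrite ee'.
- by case: (eP i) => eE es _ ej; rewrite mon_gt0_col // es ej !eqxx.
by move=> eD; exists (e i); case: (eP i).
Qed.

Variables (tup : r.-tuple {mpoly k[N]}) (I : {mpoly k[r]} -> Prop).
Hypothesis tupE : forall i, tnth tup i = 'X_[mon i].
Hypothesis IE : forall p, I p <-> (p \mPo tup = 0)%R.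

Lemma grid_shift_exists (F : minimal_resolution I) : 0 < t ->
  exists q, 0 < q /\ exists a : 'I_(res_rank F q.-1),
    res_shift a = q + \sum_s (n s).-1.
Proof.
move=> t_gt0; exists (#|U| - size rows).
have q_gt0 : 0 < #|U| - size rows.
  have [<- _ _] := grid_cycle_degree (grid_cycle_hook k n_gt1 cell_inj cell_ex).
  (* The cell in row 0 and column 1 belongs to the hook. *)
  pose s := Ordinal t_gt0; have n2 := n_gt1 s.
  have [b [bE bs bi bj]] := @cell_ex s 0 1 ltac:(lia) ltac:(lia).
  by apply/card_gt0P; exists b; rewrite !inE bE bs bi bj n2.
split=> //; rewrite -size_row_list.
apply: (toric_shift_exists (diag_ltC comp ro co) tupE IE F
  (alpha := alpha) (z := cyc) (phi := stair_cochain k n E comp ro co) (zm := residue)) => //.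
- exact: grid_cycle_degree.
- move=> A; apply: row_cycle_closed; first exact: diag_ltC.
    exact: row_list_uniq.
  by move=> b; rewrite inE mem_row_list // => /andP[].
- by move=> G /degree_covers[sGE cov]; apply: stair_cocycle.
- exact: stair_grid_pairing.
Qed.

End GridDegree.

(** * Regularity of toric ideals of graphs *)

Lemma bettiP (k : fieldType) r (I : {mpoly k[r]} -> Prop)
    (F : minimal_resolution I) i j :
  betti F i j <> 0%N <-> exists a : 'I_(res_rank F i), res_shift a = j.
Proof.
split=> [/eqP|[a <-]]; last first.
  by apply/eqP; rewrite -lt0n; apply/card_gt0P; exists a; rewrite inE.
by rewrite -lt0n => /card_gt0P[a]; rewrite inE => /eqP <-; exists a.
Qed.

Lemma regularity_ge (k : fieldType) r (I : {mpoly k[r]} -> Prop)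
    (F : minimal_resolution I) i (a : 'I_(res_rank F i)) :
  exists2 reg : int, is_regularity F reg & (res_shift a)%:Z - i%:Z <= reg.
Proof.
have [p pP] := res_finite F.
have ltp j (b : 'I_(res_rank F j)) : (j < p)%N.
  by rewrite ltnNge; apply/negP => /pP r0; case: b => c; rewrite r0.
pose idx := {j : 'I_p & 'I_(res_rank F j)}.
pose x0 : idx := Tagged (fun j : 'I_p => 'I_(res_rank F j)) (i := Ordinal (ltp i a)) a.
(* Adding [p - j] in place of subtracting [j < p] keeps the maximized quantity in [nat]. *)
pose v (x : idx) : nat := (res_shift (tagged x) + (p - tag x))%N.
case: (@arg_maxnP _ x0 predT v isT) => x _ xmax.
have aux (e e' j j' : nat) : (j < p)%N -> (j' < p)%N ->
    (e' + (p - j') <= e + (p - j))%N -> e'%:Z - j'%:Z <= e%:Z - j%:Z by lia.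
have bnd j (b : 'I_(res_rank F j)) :
    (res_shift b)%:Z - j%:Z <= (res_shift (tagged x))%:Z - (tag x : nat)%:Z.
  pose y : idx := Tagged (fun j : 'I_p => 'I_(res_rank F j)) (i := Ordinal (ltp j b)) b.
  exact: (aux _ _ _ _ (ltn_ord (tag x)) (ltp j b) (xmax y isT)).
exists ((res_shift (tagged x))%:Z - (tag x : nat)%:Z); last exact: bnd.
split; first by exists (tag x), (res_shift (tagged x)); split=> //; apply/bettiP; exists (tagged x).
by move=> j l /bettiP[b <-]; apply: bnd.
Qed.

(** * Labelling the vertices of the induced subgraph *)

Section Labels.

Variables (G : sgraph) (W : {set G}) (t : nat) (n : 'I_t -> nat).
Hypothesis hW : graph_iso (induced W)
  (disjoint_union (fun i => complete_bipartite (n i) (n i))).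
Hypothesis n_gt0 : forall s, (0 < n s)%N.

(** Natural number labels avoid ordinals whose bound depends on the component. *)
Lemma bipartite_labels : exists R C : 'I_t -> nat -> G,
  [/\ (forall s s' i i', (i < n s)%N -> (i' < n s')%N ->
         [/\ R s i = R s' i' -> s = s' /\ i = i',
             C s i = C s' i' -> s = s' /\ i = i' & R s i <> C s' i']),
      (forall s i, (i < n s)%N -> R s i \in W /\ C s i \in W),
      (forall s i j, (i < n s)%N -> (j < n s)%N -> adj (R s i) (C s j)) &
      (forall x y, x \in W -> y \in W -> adj x y -> exists s i j,
         [/\ (i < n s)%N, (j < n s)%N & [set x; y] = [set R s i; C s j]])].
Proof.
case: hW => f [g fK gK] fadj.
pose DU := disjoint_union (fun s => complete_bipartite (n s) (n s)).
(* Indices out of range are sent to the vertex 0 of their side. *)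
pose lab (side : bool) (s : 'I_t) (i : nat) : DU :=
  let o := insubd (Ordinal (n_gt0 s)) i in
  Tagged (fun s => complete_bipartite (n s) (n s))
    (if side then inl o else inr o : complete_bipartite (n s) (n s)).
(* [key] decodes [lab] into a nondependent triple, which gives injectivity without casts. *)
pose key (x : DU) : 'I_t * bool * nat :=
  (tag x, (if tagged x is inl _ then true else false),
   (match tagged x with inl o | inr o => o : nat end)).
have keyE b s i : (i < n s)%N -> key (lab b s i) = (s, b, i).
  by move=> lti; rewrite /key /lab; case: b => /=; rewrite val_insubd lti.
pose V b s i : G := val (g (lab b s i)).
have V_inj b b' s s' i i' : (i < n s)%N -> (i' < n s')%N ->
    V b s i = V b' s' i' -> [/\ b = b', s = s' & i = i'].
  move=> lti lti' /val_inj/(can_inj gK)/(congr1 key).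
  by rewrite !keyE // => -[-> -> ->].
have labE s (x : complete_bipartite (n s) (n s)) :
    (Tagged (fun s => complete_bipartite (n s) (n s)) x : DU) = lab
       (if x is inl _ then true else false) s
       (match x with inl o | inr o => o : nat end).
  by case: x => o; rewrite /lab /=; congr Tagged; congr (_ _); apply/val_inj;
     rewrite val_insubd ltn_ord.
exists (V true), (V false); split.
- move=> s s' i i' lti lti'; split=> /V_inj h.
  + by case: h.
  + by case: h.
  + by case: h.
- by move=> s i lti; split; apply: valP.
- move=> s i j lti ltj.
  rewrite -[adj _ _]/(adj (g (lab true s i)) (g (lab false s j))) -fadj !gK.
  by rewrite /= /dunion_adj /= eqxx tagged_asE.
move=> x y xW yW xy.
pose x' : induced W := exist _ x xW; pose y' : induced W := exist _ y yW.
have : adj (f x') (f y') by rewrite fadj.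
have xE : x = val (g (f x')) by rewrite fK.
have yE : y = val (g (f y')) by rewrite fK.
have labS (u : DU) : exists b s i, (i < n s)%N /\ u = lab b s i.
  case: u => s z; exists (if z is inl _ then true else false), s.
  exists (match z with inl o | inr o => o : nat end).
  by split; [case: z => o; apply: ltn_ord | apply: labE].
rewrite xE yE.
have [b [s [i [lti ->]]]] := labS (f x'); have [b' [s' [j [ltj ->]]]] := labS (f y').
case/andP => /eqP /= ss'; case: s' / ss' ltj => ltj; rewrite tagged_asE.
case: b b' => -[] //= _; first by exists s, i, j; split.
by exists s, j, i; split; rewrite // setUC.
Qed.

End Labels.

Theorem theorem1p1 (k : fieldType) (G : sgraph)
    (t : nat) (ht : (1 <= t)%N) (n : 'I_t -> nat) (hn : forall i, (2 <= n i)%N)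
    (W : {set G})
    (hW : graph_iso (induced W)
            (disjoint_union (fun i => complete_bipartite (n i) (n i))))
    (F : minimal_resolution (@toric_ideal k G)) :
  exists2 reg : int, is_regularity F reg &
    (\sum_(i < t) n i)%N%:Z - (t%:Z - 1) <= reg.
Proof.
have n_gt0 s : (0 < n s)%N by apply: ltnW.
have [R [C [RC_inj RC_W RC_adj RC_edge]]] := bipartite_labels hW n_gt0.
pose ev (b : 'I_#|edges G|) : {set G} := enum_val b.
pose E := [set b | ev b \subset W].
pose rv s i := enum_rank (R s i); pose cv s i := enum_rank (C s i).
pose mon (b : 'I_#|edges G|) : 'X_{1..#|G|} :=
  (\big[+%MM/0%MM]_(x in ev b) U_(enum_rank x))%MM.
have /fin_all_exists[lab labP] (b : 'I_#|edges G|) : exists l : 'I_t * nat * nat,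
    b \in E -> [/\ (l.1.2 < n l.1.1)%N, (l.2 < n l.1.1)%N &
      ev b = [set R l.1.1 l.1.2; C l.1.1 l.2]].
  (* Edges outside [E] get a dummy label. *)
  have [bE|bE] := boolP (b \in E); last by exists (Ordinal ht, 0%N, 0%N).
  have /imset2P[x y _] : ev b \in edges G by apply: enum_valP.
  rewrite inE => /andP[_ xy] bxy; move: bE; rewrite inE bxy subUset !sub1set.
  by case/andP=> xW yW; have [s [i [j h]]] := RC_edge x y xW yW xy; exists (s, i, j).
pose comp b := (lab b).1.1; pose ro b := (lab b).1.2; pose co b := (lab b).2.
have cell_bound b : b \in E -> (ro b < n (comp b) /\ co b < n (comp b))%N.
  by case/labP.
have cell_inj a b : a \in E -> b \in E ->
    comp a = comp b -> ro a = ro b -> co a = co b -> a = b.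
  move=> /labP[_ _ aE] /labP[_ _ bE]; rewrite /comp /ro /co => cE rE coE.
  by apply: enum_val_inj; rewrite -/(ev a) -/(ev b) aE bE cE rE coE.
have cell_ex s i j : (i < n s)%N -> (j < n s)%N ->
    exists b, [/\ b \in E, comp b = s, ro b = i & co b = j].
  move=> lti ltj; have ed : [set R s i; C s j] \in edges G.
    by apply/imset2P; exists (R s i) (C s j); rewrite ?inE //= RC_adj.
  pose b := enum_rank_in ed [set R s i; C s j].
  have evb : ev b = [set R s i; C s j] by rewrite /ev enum_rankK_in.
  have bE : b \in E.
    by rewrite inE evb subUset !sub1set (RC_W s i lti).1 (RC_W s j ltj).2.
  (* The label of [b] was a choice; comparing endpoints, with row and column vertices disjoint,
     shows that it is [(s, i, j)]. *)
  exists b; have [lb1 lb2 lbE] := labP b bE; move: lbE; rewrite evb => /setP lbE.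
  have [injR _ nRC] := RC_inj s (comp b) i _ lti lb1.
  have [_ injC _] := RC_inj s (comp b) j _ ltj lb2.
  have [_ _ nRC1] := RC_inj s (comp b) i _ lti lb2.
  have [_ _ nRC2] := RC_inj (comp b) s _ j lb1 ltj.
  have [sE iE] : s = comp b /\ i = ro b.
    by apply: injR; have := lbE (R s i); rewrite !inE eqxx => /esym/orP[] /eqP.
  have [_ jE] : s = comp b /\ j = co b.
    apply: injC; have := lbE (C s j); rewrite !inE eqxx orbT => /esym/orP[] /eqP //.
    by move/esym.
  by split.
have rv_inj s s' i i' : (i < n s)%N -> (i' < n s')%N ->
    rv s i = rv s' i' -> s = s' /\ i = i'.
  by move=> lti lti' /enum_rank_inj; have [] := RC_inj s s' i i' lti lti'.
have cv_inj s s' i i' : (i < n s)%N -> (i' < n s')%N ->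
    cv s i = cv s' i' -> s = s' /\ i = i'.
  by move=> lti lti' /enum_rank_inj; have [] := RC_inj s s' i i' lti lti'.
have rv_cv s s' i i' : (i < n s)%N -> (i' < n s')%N -> rv s i <> cv s' i'.
  by move=> lti lti' /enum_rank_inj; have [] := RC_inj s s' i i' lti lti'.
have mon_cell b : b \in E ->
    mon b = (U_(rv (comp b) (ro b)) + U_(cv (comp b) (co b)))%MM.
  move=> /labP[lb1 lb2 evb]; rewrite /mon evb big_setU1 ?big_set1 // inE.
  by apply/eqP; have [] := RC_inj _ _ _ _ lb1 lb2.
have mon_other b : b \notin E -> exists2 v, (0 < mon b v)%N &
    forall s i, (i < n s)%N -> v <> rv s i /\ v <> cv s i.
  rewrite inE => /subsetPn[x xb xW]; exists (enum_rank x).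
    by rewrite /mon mnm_sumE (bigD1 x) //= mnm1E eqxx.
  move=> s i /(RC_W s i)[RW CW].
  by split=> /enum_rank_inj xE; rewrite xE ?RW ?CW in xW.
have tupE i : tnth [tuple edge_monomial k i | i < #|edges G|] i = 'X_[mon i].
  rewrite tnth_mktuple /mon.
  by rewrite (big_morph (fun m => 'X_[m]) (@mpolyXD _ k) (@mpolyX0 _ k)).
have [q [q_gt0 [a aE]]] := grid_shift_exists hn cell_bound cell_inj cell_ex
  rv_inj cv_inj rv_cv mon_cell mon_other tupE (fun p => iff_refl _) F ht.
have [reg regP le_reg] := regularity_ge a; exists reg => //.
(* The generator contributes [q + X - (q - 1) = X + 1], with [X] the sum of the [n s - 1]. *)
have sumE : (\sum_(s < t) n s = \sum_(s < t) (n s).-1 + t)%N.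
  transitivity (\sum_(s < t) ((n s).-1 + 1))%N.
    by apply: eq_bigr => s _; rewrite addn1 prednK.
  by rewrite big_split sum_nat_const card_ord muln1.
move: le_reg; rewrite aE sumE; move: (\sum_(s < t) (n s).-1)%N => X.
by clear -q_gt0; lia.
Qed.
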